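(* Let $H\in[1/2,1)$, $\alpha\ge0$, $\gamma>0$, $t_0\ge0$. Let $X(t)$ be the solution (given by its Karhunen-Loève expansion in the context) of $dX(t)+\psi(-\Delta^{*})X(t)\,dt=dB^{H}(t)$ on $\mathbb{S}^2$ with $X(0)=u(t_0)$, where the angular power spectrum $\mathcal{C}_\ell$ of the initial random field $T_0$ and the variances $\mathcal{A}_\ell$ of the fractional Brownian motion $B^{H}$ satisfy $$\sum_{\ell=0}^{\infty}(2\ell+1)\bigl(\mathcal{C}_\ell+(1+\psi(\lambda_\ell))^{2}\mathcal{A}_\ell\bigr)<\infty .$$ Then, for $t\ge0$, as $h\to0+$, $$\|X(t+h)-X(t)\|_{L_2(\Omega\times\mathbb{S}^2)}\le C\,h^{H},$$ where the constant $C$ depends only on $\alpha$, $\gamma$, $t$, $(\mathcal{C}_\ell)_{\ell\ge0}$ and $(\mathcal{A}_\ell)_{\ell\ge0}$.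
   Context: ''As $h\to0+$'' means for all sufficiently small $h>0$. $\mathbb{S}^2\subset\mathbb{R}^3$ is the unit sphere with normalized surface measure $\mu$, $(\Omega,\mathcal F,P)$ is a probability space, and $\|Z\|_{L_2(\Omega\times\mathbb{S}^2)}^2=E\int_{\mathbb{S}^2}|Z|^2d\mu$. $\{Y_{\ell,m}:\ell\ge0,\ -\ell\le m\le\ell\}$ is the complex orthonormal basis of spherical harmonics (orthonormal with respect to $\mu$), $Y_{\ell,m}=\sqrt{(2\ell+1)\frac{(\ell-m)!}{(\ell+m)!}}\,P_\ell^{m}(\cos\theta)e^{im\varphi}$, with $Y_{\ell,m}=(-1)^m\overline{Y_{\ell,-m}}$. Fourier coefficients are $\widehat f_{\ell m}=\int f\,\overline{Y_{\ell,m}}\,d\mu$. $\Delta^{*}$ is the Laplace-Beltrami operator, $-\Delta^{*}Y_{\ell,m}=\lambda_\ell Y_{\ell,m}$, $\lambda_\ell=\ell(\ell+1)$; $\psi(t)=t^{\alpha/2}(1+t)^{\gamma/2}$; $\psi(-\Delta^{*})$ has eigenvalue $\psi(\lambda_\ell)$ on $Y_{\ell,m}$. $T_0$ is a centered ($E[T_0(\mathbf{x})]=0$), $2$-weakly isotropic (finite second moments, rotation-invariant first and second order moments) real Gaussian random field on $\mathbb{S}^2$; its angular power spectrum $(\mathcal{C}_\ell)$ is defined by $E[T_0(\mathbf{x})T_0(\mathbf{y})]=\sum_\ell\mathcal{C}_\ell(2\ell+1)P_\ell(\mathbf{x}\cdot\mathbf{y})$, $P_\ell$ the Legendre polynomials.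 $u(t)=\sum_{\ell,m}e^{-\psi(\lambda_\ell)t}\widehat{(T_0)}_{\ell m}Y_{\ell,m}$ is the solution of $\partial_tu+\psi(-\Delta^{*})u=0$, $u(0)=T_0$. A real fractional Brownian motion (fBm) with Hurst index $H$ and variance $1$ at $t=1$ is a centered Gaussian process $\beta$ on $[0,\infty)$ with $\beta(0)=0$, $E|\beta(t)-\beta(s)|^2=|t-s|^{2H}$. Let $\mathcal{A}_\ell>0$ with $\sum_\ell(2\ell+1)\mathcal{A}_\ell<\infty$, and let $\beta^1_{\ell m}$ ($0\le m\le\ell$), $\beta^2_{\ell m}$ ($1\le m\le\ell$), $\ell\ge0$, be independent such fBms. The fBm on $\mathbb{S}^2$ with variances $\mathcal{A}_\ell$ is $B^{H}(t)=\sum_{\ell}\sqrt{\mathcal{A}_\ell}\bigl(\beta^1_{\ell0}(t)Y_{\ell,0}+\sqrt2\sum_{m=1}^{\ell}(\beta^1_{\ell m}(t)\mathrm{Re}\,Y_{\ell,m}+\beta^2_{\ell m}(t)\mathrm{Im}\,Y_{\ell,m})\bigr)$ in $L_2(\Omega\times\mathbb{S}^2)$. Integrals of deterministic functions against $\beta^i_{\ell m}$ are Riemann-Stieltjes integrals. Write $I^i_{\ell m}(t)=\int_0^te^{-\psi(\lambda_\ell)(t-s)}d\beta^i_{\ell m}(s)$. The solution is $$X(t)=\sum_{\ell=0}^{\infty}\Bigl(\sum_{m=-\ell}^{\ell}e^{-\psi(\lambda_\ell)(t+t_0)}\widehat{(T_0)}_{\ell m}Y_{\ell,m}+\sqrt{\mathcal{A}_\ell}\Bigl(I^1_{\ell0}(t)Y_{\ell,0}+\sqrt2\sum_{m=1}^{\ell}\bigl(I^1_{\ell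 m}(t)\mathrm{Re}\,Y_{\ell,m}+I^2_{\ell m}(t)\mathrm{Im}\,Y_{\ell,m}\bigr)\Bigr)\Bigr).$$
   Formalization: The case t = t_0 = 0 is excluded (t + t_0 > 0 is assumed): there the claim fails, e.g. for C_l = 1/((2l+1)(l+1)^{1+ε}) with small ε, since the initial-field part of X(h) − X(0) is then not O(h^H). *)

(* Defs.v *)
From HB Require Import structures.
From mathcomp Require Import all_boot all_order all_algebra.
From mathcomp Require Import all_classical all_reals all_analysis.
From mathcomp Require Import measurable_realfun.
From mathcomp Require Export complex.

Set Implicit Arguments.
Unset Strict Implicit.
Unset Printing Implicit Defensive.

Import Order.TTheory GRing.Theory Num.Theory.
Import numFieldNormedType.Exports.

Local Open Scope classical_set_scope.
Local Open Scope complex_scope.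
Local Open Scope ring_scope.

(** * The sphere and its normalized surface measure *)

Definition unit_vec (R : realType) (x : 'cV[R]_3) : bool :=
  \sum_i x i 0 ^+ 2 == 1.

Definition S2 (R : realType) : Type := {x : 'cV[R]_3 | @unit_vec R x}.

Definition vec3 (R : realType) (a b c : R) : 'cV[R]_3 :=
  \col_i nth 0 [:: a; b; c] i.

Lemma vec3_norm (R : realType) (a b c : R) :
  \sum_i vec3 a b c i 0 ^+ 2 = a ^+ 2 + b ^+ 2 + c ^+ 2.
Proof. by rewrite !big_ord_recl big_ord0 !mxE /= addr0 addrA. Qed.

Lemma sph_subproof (R : realType) (th ph : R) :
  unit_vec (vec3 (sin th * cos ph) (sin th * sin ph) (cos th)).
Proof.
by rewrite /unit_vec vec3_norm !exprMn -mulrDr cos2Dsin2 mulr1 addrC cos2Dsin2.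
Qed.

(** Spherical coordinates: colatitude [z.1], longitude [z.2]. *)
Definition sph (R : realType) (z : R * R) : S2 R :=
  exist (@unit_vec R) _ (sph_subproof z.1 z.2).

HB.instance Definition _ (R : realType) := gen_eqMixin (S2 R).
HB.instance Definition _ (R : realType) := gen_choiceMixin (S2 R).
HB.instance Definition _ (R : realType) :=
  isPointed.Build (S2 R) (sph (0, 0)).

Definition coords (R : realType) (x : S2 R) :
    R * R * R :=
  (sval x 0 0, sval x 1 0, sval x (inord 2) 0).

(** The Borel sigma-algebra of the sphere, as the trace of that of R^3. *)
HB.instance Definition _ (R : realType) :=
  Measurable.copy (S2 R) (g_sigma_algebra_preimageType (@coords R)).

Lemma measurable_sph (R : realType) :
  measurable_fun setT
    (@sph R : R * R -> S2 R).
Proof.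
move=> _ A [B mB <-]; rewrite !setTI -comp_preimage.
rewrite -[X in measurable X]setTI.
have m1 (f : R -> R) : continuous f ->
    measurable_fun setT (fun z : R * R => f z.1).
  by move=> cf; apply: measurableT_comp => //; exact: continuous_measurable_fun.
have m2 (f : R -> R) : continuous f ->
    measurable_fun setT (fun z : R * R => f z.2).
  by move=> cf; apply: measurableT_comp => //; exact: continuous_measurable_fun.
have -> : @coords R \o @sph R = fun z =>
    (sin z.1 * cos z.2, sin z.1 * sin z.2, cos z.1).
  by apply/funext => z; rewrite /coords /= !mxE /= inordK.
have mF : measurable_fun setT
    (fun z : R * R =>
      (sin z.1 * cos z.2 : R,
       sin z.1 * sin z.2 : R, cos z.1 : R)).
  apply: measurable_fun_pair; last exact: m1 (@continuous_cos R).
  apply: measurable_fun_pair; apply: measurable_funM.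
  - exact: m1 (@continuous_sin R).
  - exact: m2 (@continuous_cos R).
  - exact: m1 (@continuous_sin R).
  - exact: m2 (@continuous_sin R).
exact: mF.
Qed.

Definition angles (R : realType) : set (R * R) :=
  `[0, pi]%classic `*` `[0, 2 * pi]%classic.

(** [dmu = sin(theta) dtheta dphi / (4 pi)] on [[0, pi] x [0, 2 pi]]. *)
Definition mu_sphere (R : realType) (A : set (S2 R)) : \bar R :=
  (\int[lebesgue_measure \x lebesgue_measure]_(z in
      (@sph R @^-1` A) `&` @angles R)
    (sin z.1 / (4 * pi))%:E)%E.

Section mu_sphere_measure.
Variable R : realType.

Local Notation T2 := (R * R)%type.
Let D : set T2 := @angles R.

Let mD : measurable D.
Proof. by apply: measurableX; exact: measurable_itv. Qed.

Let mpre (A : set (S2 R)) : measurable A ->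
  measurable ((@sph R @^-1` A : set T2) `&` D).
Proof.
move=> mA; apply: measurableI => //.
by rewrite -[X in measurable X]setTI; exact: measurable_sph.
Qed.

Let dens_ge0 (z : T2) : D z -> (0 <= (sin z.1 / (4 * pi))%:E)%E.
Proof.
move=> [/= z1 _]; rewrite lee_fin divr_ge0 //.
  by apply: sin_ge0_pi; rewrite in_itv /= in z1.
by rewrite mulr_ge0 // pi_ge0.
Qed.

Let mdens (E : set T2) :
  measurable_fun E (fun z : T2 => (sin z.1 / (4 * pi))%:E).
Proof.
apply/measurable_EFinP; apply: measurable_funM => //.
apply: (measurable_funS measurableT) => //.
apply: measurableT_comp => //.
exact: (continuous_measurable_fun (@continuous_sin R)).
Qed.

Let mu_sphere0 : mu_sphere (@set0 (S2 R)) = 0%E.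
Proof. by rewrite /mu_sphere preimage_set0 set0I integral_set0. Qed.

Let mu_sphere_ge0 (A : set (S2 R)) : (0 <= mu_sphere A)%E.
Proof. by apply: integral_ge0 => z [_ Dz]; exact: dens_ge0. Qed.

Let mu_sphere_sigma_additive : semi_sigma_additive (@mu_sphere R).
Proof.
move=> F mF tF mUF; rewrite /mu_sphere.
rewrite preimage_bigcup setI_bigcupl ge0_integral_bigcup /=; first last.
- move=> i j _ _ [z [[Fi _] [Fj _]]].
  by apply: (tF i j Logic.I Logic.I); exists (sph z).
- by move=> z [i _ [_ Dz]]; exact: dens_ge0.
- exact: mdens.
- by move=> i; exact: mpre.
apply: is_cvg_ereal_nneg_natsum => n _.
by apply: integral_ge0 => z [_ Dz]; exact: dens_ge0.
Qed.

HB.instance Definition _ := isMeasure.Build _ (S2 R) R (@mu_sphere R)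
  mu_sphere0 mu_sphere_ge0 mu_sphere_sigma_additive.

End mu_sphere_measure.

Section spherical_harmonics.
Variable R : realType.
Implicit Types (l m : nat) (x y : S2 R).

Definition dotS x y : R := \sum_i sval x i 0 * sval y i 0.

Definition colatitude x : R := acos (sval x (inord 2) 0).

(** Longitude in [[0, 2 pi]]; its (irrelevant) value at the poles is [pi / 2]. *)
Definition longitude x : R :=
  let c := acos (sval x 0 0 / Num.sqrt (sval x 0 0 ^+ 2 + sval x 1 0 ^+ 2)) in
  if 0 <= sval x 1 0 then c else 2 * pi - c.

(** Rodrigues' formula. *)
Definition legendre l : {poly R} :=
  (2 ^+ l * l`!%:R)^-1 *: (('X^2 - 1) ^+ l)^`(l).

(** Associated Legendre function of order [m >= 0], with the Condon-Shortley
    phase. *)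
Definition assoc_legendre l m (s : R) : R :=
  (-1) ^+ m * Num.sqrt (1 - s ^+ 2) ^+ m * ((legendre l)^`(m)).[s].

Definition sph_harm_nonneg l m x : R[i] :=
  (Num.sqrt ((2 * l + 1)%N%:R * (l - m)`!%:R / (l + m)`!%:R)
     * assoc_legendre l m (cos (colatitude x)))%:C
  * (cos (m%:R * longitude x) +i* sin (m%:R * longitude x)).

(** Negative orders: [Y_{l,m} = (-1)^m conj Y_{l,-m}]. *)
Definition sph_harm l (m : int) x : R[i] :=
  match m with
  | Posz k => sph_harm_nonneg l k x
  | Negz k => (-1) ^+ k.+1 * conjc (sph_harm_nonneg l k.+1 x)
  end.

Definition integral_sphere (f : S2 R -> R[i]) : R[i] :=
  (\int[@mu_sphere R]_x complex.Re (f x))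
  +i* (\int[@mu_sphere R]_x complex.Im (f x)).

Definition fourier_coef (f : S2 R -> R) l (m : int) : R[i] :=
  integral_sphere (fun x => (f x)%:C * conjc (sph_harm l m x)).

Definition eigval l : R := l%:R * (l%:R + 1).

Definition psi (alpha gamma s : R) : R :=
  s `^ (alpha / 2) * (1 + s) `^ (gamma / 2).

End spherical_harmonics.

Section random_fields.
Context d (Omega : measurableType d) (R : realType).
Variable P : probability Omega R.

(** Possibly degenerate normal law; [normal_prob] is not a point mass when its
    standard deviation is [0]. *)
Definition gaussian_rv (X : Omega -> R) : Prop :=
  measurable_fun setT X /\
  exists m s : R, forall A : set R, measurable A ->
    P (X @^-1` A) = if s == 0 then \d_m A else normal_prob m s A.

Definition gaussian_process (I : Type) (D : set I) (X : I -> Omega -> R) :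
    Prop :=
  forall (n : nat) (a : 'I_n -> R) (i : 'I_n -> I), (forall k, D (i k)) ->
    gaussian_rv (fun w => \sum_(k < n) a k * X (i k) w).

Definition rotation (M : 'M[R]_3) : Prop := M^T *m M = 1%:M /\ \det M = 1.

Definition weakly_isotropic2 (T : S2 R -> Omega -> R) : Prop :=
  [/\ forall x, ('E_P[(fun w => T x w ^+ 2)%R] < +oo)%E,
      forall M x x', rotation M -> sval x' = M *m sval x ->
        ('E_P[T x'] = 'E_P[T x])%E
    & forall M x y x' y', rotation M ->
        sval x' = M *m sval x -> sval y' = M *m sval y ->
        ('E_P[(fun w => T x' w * T y' w)%R] = 'E_P[(fun w => T x w * T y w)%R])%E].

Definition angular_power_spectrum (T : S2 R -> Omega -> R) (C : R^nat) : Prop :=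
  forall x y, exists2 c : R,
    ('E_P[(fun w => T x w * T y w)%R] = c%:E)%E &
    [series C l * (2 * l + 1)%N%:R * (legendre R l).[dotS x y]]_l @ \oo --> c.

Definition initial_field (T : S2 R -> Omega -> R) (C : R^nat) : Prop :=
  [/\ measurable_fun setT (fun z : Omega * S2 R => T z.2 z.1),
      gaussian_process setT T,
      forall x, ('E_P[T x] = 0)%E,
      weakly_isotropic2 T
    & angular_power_spectrum T C].

Definition fBm (H : R) (b : R -> Omega -> R) : Prop :=
  [/\ gaussian_process [set s | 0 <= s] b,
      forall s, 0 <= s -> ('E_P[b s] = 0)%E,
      {ae P, forall w, b 0 w = 0}
    & forall r s, 0 <= r -> 0 <= s ->
        ('E_P[(fun w => (b r w - b s w) ^+ 2)%R]
          = (`|r - s| `^ (2 * H))%R%:E)%E].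

Definition process_sigma_algebra (b : R -> Omega -> R) : set (set Omega) :=
  <<s [set A | exists s (B : set R),
        [/\ 0 <= s, measurable B & A = b s @^-1` B]] >>.

Definition independent_processes (I : choiceType) (D : set I)
    (b : I -> R -> Omega -> R) : Prop :=
  forall (J : seq I) (A : I -> set Omega), uniq J ->
    (forall i, i \in J -> D i /\ process_sigma_algebra (b i) (A i)) ->
    P (\bigcap_(i in [set` J]) A i) = (\prod_(i <- J) P (A i))%E.

(** The components [beta1 l m], [0 <= m <= l], and [beta2 l m], [1 <= m <= l]. *)
Definition fBm_components (H : R) (beta1 beta2 : nat -> nat -> R -> Omega -> R) :
    Prop :=
  [/\ forall l m, (m <= l)%N -> fBm H (beta1 l m),
      forall l m, (1 <= m <= l)%N -> fBm H (beta2 l m)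
    & independent_processes
        [set k : nat * nat + nat * nat |
          match k with
          | inl lm => (lm.2 <= lm.1)%N
          | inr lm => (1 <= lm.2 <= lm.1)%N
          end]
        (fun k => match k with
                  | inl lm => beta1 lm.1 lm.2
                  | inr lm => beta2 lm.1 lm.2
                  end)].

(** [I] is the Riemann-Stieltjes integral of [f] against [b] over [[u, v]]:
    the mean-square limit of the tagged Riemann-Stieltjes sums as the mesh tends
    to [0]. When [f] is smooth and [b] has continuous paths, it is almost surely
    the pathwise integral. *)
Definition RS_integral (f : R -> R) (b : R -> Omega -> R) (u v : R)
    (I : Omega -> R) : Prop :=
  measurable_fun setT I /\
  forall e : R, 0 < e -> exists2 delta : R, 0 < delta &
    forall (n : nat) (s xi : nat -> R), s 0%N = u -> s n = v ->
      (forall i, (i < n)%N ->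
        [/\ s i <= xi i, xi i <= s i.+1 & s i.+1 - s i < delta]) ->
      ('E_P[(fun w => (I w -
         \sum_(i < n) f (xi i) * (b (s i.+1) w - b (s i) w)) ^+ 2)%R] <= e%:E)%E.

Definition L2norm (Z : Omega -> S2 R -> R[i]) : \bar R :=
  ((\int[P]_w \int[@mu_sphere R]_x
       (complex.Re (Z w x) ^+ 2 + complex.Im (Z w x) ^+ 2)%R%:E)
     `^ 2^-1%R)%E.

End random_fields.

Section solution.
Context d (Omega : measurableType d) (R : realType).
Variable P : probability Omega R.
Variables (alpha gamma t0 : R) (A : R^nat) (T0 : S2 R -> Omega -> R).

Local Notation psil l := (psi alpha gamma (eigval R l)).

(** The integrals [I l m t] of [exp(-psi(lambda_l)(t - s)) dbeta_{l,m}(s)] over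
    [[0, t]], for [t >= 0] and the orders [m] in [[m0, l]]. *)
Definition OU_integrals (m0 : nat) (beta I : nat -> nat -> R -> Omega -> R) :
    Prop :=
  forall l m t, (m0 <= m <= l)%N -> 0 <= t ->
    RS_integral P (fun s => expR (- psil l * (t - s))) (beta l m) 0 t (I l m t).

Variables I1 I2 : nat -> nat -> R -> Omega -> R.

Definition initial_term (l : nat) (t : R) (w : Omega) (x : S2 R) : R[i] :=
  \sum_(k < (2 * l).+1)
    let m := k%:Z - l%:Z in
    (expR (- psil l * (t + t0)))%:C * fourier_coef (T0^~ w) l m
      * sph_harm l m x.

Definition noise_term (l : nat) (t : R) (w : Omega) (x : S2 R) : R[i] :=
  (Num.sqrt (A l))%:C *
    ((I1 l 0 t w)%:C * sph_harm l 0 x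
     + (Num.sqrt 2)%:C * \sum_(1 <= m < l.+1)
         (I1 l m t w * complex.Re (sph_harm l m x)
          + I2 l m t w * complex.Im (sph_harm l m x))%:C).

(** [X t] is the sum, in [L_2(Omega x S^2)], of its Karhunen-Loeve expansion. *)
Definition KL_solution (X : R -> Omega -> S2 R -> R[i]) : Prop :=
  forall t, 0 <= t ->
    [/\ measurable_fun setT (fun z : Omega * S2 R => complex.Re (X t z.1 z.2)),
        measurable_fun setT (fun z : Omega * S2 R => complex.Im (X t z.1 z.2))
      & L2norm P (fun w x => X t w x
          - \sum_(l < n) (initial_term l t w x + noise_term l t w x))
          @[n --> \oo] --> 0%E].

End solution.

(* Main.v *)
Require Import Defs.
From HB Require Import structures.
From mathcomp Require Import all_boot all_order all_algebra.
From mathcomp Require Import all_classical all_reals all_analysis.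
From mathcomp Require Import ring lra zify measurable_realfun.

(** The real functions [Y_{l,0}], [sqrt 2 Re Y_{l,m}], [sqrt 2 Im Y_{l,m}] are
    orthonormal in [L_2(S^2)], and in this basis the partial sums of the expansion
    of [X (t + h) - X t] have the coefficients
    [(e^{-psi_l (t+h+t0)} - e^{-psi_l (t+t0)}) <T0, e> + sqrt A_l (I (t + h) - I t)].
    By orthonormality and Bessel's inequality their squared norm is at most twice
    [D^2 E ||T0||^2 + sum_l (2 l + 1) A_l E |I (t + h) - I t|^2], where [D] bounds the
    differences of exponentials; one can take [D = h / (t + t0)], which is at most
    [h^H] once [h^{1-H} <= t + t0], so that [t0] and [H] do not enter the constant.
    For [H >= 1/2] the increments of a fractional Brownian motion are nonnegatively
    correlated, so a Riemann-Stieltjes integral over [[u, v]] of an integrand bounded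
    by [M] has second moment at most [M^2 (v - u)^{2H}]; applied on [[0, t]] with
    [M = psi_l h] and on [[t, t + h]] with [M = 1] this gives
    [E |I (t + h) - I t|^2 <= C (1 + psi_l)^2 h^{2H}]. *)

Set Implicit Arguments.
Unset Strict Implicit.
Unset Printing Implicit Defensive.

Import Order.TTheory GRing.Theory Num.Theory.
Import numFieldNormedType.Exports.

Local Open Scope classical_set_scope.
Local Open Scope complex_scope.
Local Open Scope ring_scope.

(** * Legendre polynomials *)

(** A large part of the development derives the orthonormality that the overview takes for granted.
    In angles the surface integral splits into a trigonometric integral and, with [s = cos theta],
    an integral of polynomials over [-1, 1], which Rodrigues' formula and integration by parts
    evaluate.

    Three obstacles shape the rest. [C_l] is weighted by [2 l + 1] alone, without any power of
    [psi_l], so the bound on the differences of exponentials must be uniform in [l]: it comes from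
    [x e^{-x} <= 1] at [x = psi_l (t + t0)], whence the condition [0 < t + t0]. The stochastic
    integrals are known only as mean-square limits, so their moments are bounded on
    Riemann-Stieltjes sums over a common partition that has [t] among its nodes. [X t] itself is
    known only as a limit of partial sums, so the bound on these is uniform in [n] and passes to [X]
    with an arbitrarily small error.

    Norms stay squared throughout: [(a_1 + ... + a_k)^2 <= k (a_1^2 + ... + a_k^2)] replaces the
    triangle inequality and disposes of cross terms, which is the origin of the factors 2, 3 and 4
    in the constant. *)

(** Reduces an equation that follows from a multiple of a known one to a ring identity: only the
    multiplier [k] has to be supplied. *)
Lemma eqr_of_subM (A : pzRingType) (k a b c e : A) : a = b -> c - e = k * (a - b) -> c = e.
Proof. by move=> -> /eqP; rewrite subrr mulr0 subr_eq0 => /eqP. Qed.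

(** * Exact integration of polynomials over [-1, 1] *)

Section polynomial_integral.
Variable R : realFieldType.
Implicit Types p q : {poly R}.

Definition poly_prim p : {poly R} :=
  \poly_(i < (size p).+1) (p`_i.-1 / i%:R *+ (0 < i)%N).

Lemma coef_poly_prim p i : (poly_prim p)`_i = p`_i.-1 / i%:R *+ (0 < i)%N.
Proof.
rewrite coef_poly; case: ltnP => // sp.
case: i sp => //= i sp; rewrite nth_default ?mul0r ?mul0rn //.
Qed.

Lemma deriv_poly_prim p : (poly_prim p)^`() = p.
Proof.
apply/polyP => i; rewrite coef_deriv coef_poly_prim /= mulr1n.
by rewrite -mulrnAr -[_ *+ _ as X in _ * X]mulr_natr mulVf ?mulr1 ?pnatr_eq0.
Qed.

Lemma poly_prim_deriv p : poly_prim p^`() = p - (p`_0)%:P.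
Proof.
apply/polyP => -[|i]; rewrite coef_poly_prim coefB coefC /= ?subrr//.
by rewrite coef_deriv mulr1n subr0 -[_ *+ i.+1 in LHS]mulr_natr mulfK // pnatr_eq0.
Qed.

(* The integral of [p] over [[-1, 1]]. *)
Definition poly_int p : R := (poly_prim p).[1] - (poly_prim p).[-1].

Lemma poly_int_deriv p : poly_int p^`() = p.[1] - p.[-1].
Proof. by rewrite /poly_int poly_prim_deriv !hornerE opprB addrA subrK. Qed.

Lemma poly_intD p q : poly_int (p + q) = poly_int p + poly_int q.
Proof.
have -> : p + q = (poly_prim p + poly_prim q)^`() by rewrite derivD !deriv_poly_prim.
by rewrite poly_int_deriv /poly_int !hornerD; ring.
Qed.

Lemma poly_intZ a p : poly_int (a *: p) = a * poly_int p.
Proof.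
have -> : a *: p = (a *: poly_prim p)^`() by rewrite derivZ deriv_poly_prim.
by rewrite poly_int_deriv /poly_int !hornerZ; ring.
Qed.

End polynomial_integral.

(** * Rodrigues' formula: differential equation, orthogonality, norms *)

Section legendre_polynomials.
Variable R : realType.
Implicit Types (l m k : nat).

Let w l : {poly R} := ('X^2 - 1) ^+ l.

Let w_deriv l : ('X^2 - 1) * (w l)^`() = (2 * l)%:R * 'X * w l.
Proof.
rewrite /w deriv_exp derivB derivXn derivC subr0 /=.
case: l => [|l]; first by rewrite mulr0n muln0 !mul0r mulr0.
rewrite -[_ *+ l.+1]mulr_natl [l.+1.-1]/= [(_ - _) ^+ l.+1]exprS expr1 natrM; ring.
Qed.

(** This is [w_deriv] differentiated [k + 1] times by Leibniz' rule; the factor ['X^2 - 1] has no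
    derivative beyond the second, so three terms remain on the left. At [k = l + m] it becomes
    [legendre_ode]. *)
Let w_ode l k :
  ('X^2 - 1) * (w l)^`(k.+2) + (2 * k.+1)%:R * 'X * (w l)^`(k.+1)
    + (k.+1 * k)%:R * (w l)^`(k) =
  (2 * l)%:R * ('X * (w l)^`(k.+1) + k.+1%:R * (w l)^`(k)).
Proof.
have dn n (p : {poly R}) : (n%:R * p)^`() = n%:R * p^`().
  by rewrite mulr_natl derivMn mulr_natl.
have dX : ('X^2 - 1 : {poly R})^`() = 2%:R * 'X.
  by rewrite derivB derivXn derivC subr0 mulr_natl.
elim: k => [|k IH].
  have := congr1 (fun p => p^`()) (w_deriv l).
  rewrite -!mulrA !dn !derivM dX derivX => h; apply: (@eqr_of_subM _ 1 _ _ _ _ h).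
  by rewrite derivn1 derivn0 derivnS derivn1; ring.
have := congr1 (fun p => p^`()) IH.
rewrite -!mulrA !derivD !dn derivD !dn !derivM dX derivX -!derivnS => h.
by apply: (@eqr_of_subM _ 1 _ _ _ _ h); ring.
Qed.

Local Notation P l := (legendre R l).

Lemma legendre_ode l m :
  (1 - 'X^2) * (P l)^`(m.+2) - (2 * m.+1)%:R * 'X * (P l)^`(m.+1)
    + (l%:R - m%:R) * (l + m).+1%:R * (P l)^`(m) = 0.
Proof.
have PE n : (P l)^`(n) = (2 ^+ l * l`!%:R)^-1 *: (w l)^`(l + n).
  by rewrite /legendre -/(w l) derivnZ /derivn addnC iterD.
rewrite !PE !addnS -!mul_polyC; set c := _%:P.
by apply: (@eqr_of_subM _ (- c) _ _ _ _ (w_ode l (l + m))); ring.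
Qed.

(** The integral of the product of two associated Legendre functions of the same order: their phases
    cancel, and the two powers of [sqrt (1 - s^2)] combine into a polynomial weight. *)
Definition legendre_ip l l' m : R :=
  poly_int ((1 - 'X^2) ^+ m * (P l)^`(m) * (P l')^`(m)).

(** Integration by parts: [legendre_ode] in self-adjoint form gives the derivative of [F], and the
    boundary terms vanish with [1 - s^2] at both ends. The factor involves [l] only, although the
    integral is symmetric in [l] and [l']; orthogonality rests on this. *)
Lemma legendre_ipS l l' m :
  legendre_ip l l' m.+1 = (l%:R - m%:R) * (l + m).+1%:R * legendre_ip l l' m.
Proof.
pose F := (1 - 'X^2) ^+ m.+1 * (P l)^`(m.+1).
have dF : F^`() = - ((l%:R - m%:R) * (l + m).+1%:R * ((1 - 'X^2) ^+ m * (P l)^`(m))).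
  rewrite derivM deriv_exp -!derivnS derivB derivXn derivC sub0r -!pred_Sn.
  apply: (@eqr_of_subM _ ((1 - 'X^2) ^+ m) _ _ _ _ (legendre_ode l m)).
  by rewrite [(_ - _) ^+ m.+1]exprS natrM; ring.
have := poly_int_deriv (F * (P l')^`(m)).
rewrite derivM -derivnS dF /F !hornerM !horner_exp !hornerE expr1n sqrrN expr1n.
rewrite subrr expr0n /= !mul0r subrr -derivnS => h.
set c := (X in _ = X * _).
have cE : c%:P = (l%:R - m%:R) * (l + m).+1%:R by rewrite rmorphM rmorphB !rmorph_nat.
apply: (@eqr_of_subM _ 1 _ _ _ _ h).
rewrite /legendre_ip subr0 mul1r -[- (c * _)]mulNr -poly_intZ -poly_intD -!mul_polyC.
rewrite polyCN cE -derivnS.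
by congr poly_int; ring.
Qed.

Lemma legendre_ipC l l' m : legendre_ip l l' m = legendre_ip l' l m.
Proof. by rewrite /legendre_ip mulrAC. Qed.

Lemma legendre_ip_orth l l' m : l != l' -> legendre_ip l l' m = 0.
Proof.
(* At [m = 1] the recurrence gives [l (l + 1) ip = l' (l' + 1) ip], by symmetry. *)
move=> ll'; suff h0 : legendre_ip l l' 0 = 0.
  by elim: m => // m IH; rewrite legendre_ipS IH mulr0.
have := legendre_ipS l l' 0; rewrite legendre_ipC legendre_ipS legendre_ipC.
move/eqP; rewrite -subr_eq0 -mulrBl mulf_eq0 !subr0 !addn0 -!natrM => /orP[|/eqP//].
rewrite subr_eq0 eqr_nat => /eqP h; case/eqP: ll'.
by nia.
Qed.

Lemma legendre_ip_fact l l' m : (m <= l)%N ->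
  legendre_ip l l' m = (l + m)`!%:R / (l - m)`!%:R * legendre_ip l l' 0.
Proof.
elim: m => [_|m IH ml]; first by rewrite addn0 subn0 divff ?mul1r// pnatr_eq0 -lt0n fact_gt0.
rewrite legendre_ipS IH 1?ltnW// mulrA; congr (_ * _).
have -> : (l - m = (l - m.+1).+1)%N by lia.
rewrite addnS !factS !natrM subnSK // natrB 1?ltnW//.
have f0 : (l - m.+1)`!%:R != 0 :> R by rewrite pnatr_eq0 -lt0n fact_gt0.
have g0 : l%:R - m%:R != 0 :> R by rewrite subr_eq0 eqr_nat; lia.
by field; rewrite f0 g0.
Qed.

Lemma derivn_size (p : {poly R}) n : (size p <= n.+1)%N -> p^`(n) = (n`!%:R * p`_n)%:P.
Proof.
move=> sp; apply/polyP => -[|i]; rewrite coef_derivn coefC /=.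
  by rewrite addn0 ffactnn mulr_natl.
by rewrite nth_default ?mul0rn // (leq_trans sp) // addnS ltnS leq_addr.
Qed.

Lemma legendre_deriv_top l : (P l)^`(l) = ((2 * l)`!%:R / (2 ^+ l * l`!%:R))%:P.
Proof.
have mX : 'X^2 - 1 \is @monic R by rewrite -polyC1 monicXnsubC.
have sw : size (w l) = (2 * l).+1.
  have := size_exp ('X^2 - 1 : {poly R}) l; rewrite -polyC1 size_XnsubC //= => <-.
  rewrite -/(w l) prednK // size_poly_gt0; exact/monic_neq0/monic_exp.
rewrite /legendre -/(w l) derivnZ /derivn -iterD addnn -mul2n -/(derivn _ _).
rewrite derivn_size ?sw //; have : lead_coef (w l) = 1 by exact/monicP/monic_exp.
by rewrite lead_coefE sw /= => ->; rewrite mulr1 -mul_polyC -polyCM mulrC.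
Qed.

(** A Wallis integral. Its recurrence comes from integrating the derivative of
    ['X * (1 - 'X^2) ^+ l.+1], which vanishes at both ends. *)
Lemma poly_int_one_sub_sqr l :
  poly_int ((1 - 'X^2) ^+ l : {poly R}) = 2 * (2 ^+ l * l`!%:R) ^+ 2 / (2 * l).+1`!%:R.
Proof.
elim: l => [|l IH].
  have := poly_int_deriv ('X : {poly R}); rewrite derivX !hornerX expr0 => ->.
  by rewrite muln0 /= factS fact0; field.
have := poly_int_deriv ('X * (1 - 'X^2) ^+ l.+1 : {poly R}).
rewrite derivM derivX deriv_exp derivB derivXn derivC sub0r -!pred_Sn.
rewrite !hornerM !horner_exp !hornerE expr1n sqrrN expr1n subrr expr0n /= !mulr0 subrr.
set k := poly_int (_ ^+ l.+1) => h.
have {h} h : (2 * l).+3%:R * k = (2 * l).+2%:R * poly_int ((1 - 'X^2) ^+ l : {poly R}).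
  apply: (@eqr_of_subM _ 1 _ _ _ _ h); rewrite subr0 mul1r -mulNr -!poly_intZ -poly_intD.
  congr poly_int; rewrite -!mul_polyC rmorphN !rmorph_nat [_ ^+ l.+1]exprS; ring.
have -> : k = (2 * l).+2%:R / (2 * l).+3%:R * poly_int ((1 - 'X^2) ^+ l : {poly R}).
  by rewrite mulrAC -h mulrC mulKf // pnatr_eq0.
rewrite IH mulnS !factS !natrM !exprS.
have f0 : (2 * l)`!%:R != 0 :> R by rewrite pnatr_eq0 -lt0n fact_gt0.
have l0 : 0 <= l%:R :> R by rewrite ler0n.
by field; apply/and4P; split=> //; apply: lt0r_neq0; lra.
Qed.

(** The recurrence in [m] is read backwards from [m = l], where both derivatives are constants and
    the Wallis integral gives the value; this fixes the case [m = 0] and hence all others. *)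
Lemma legendre_ip_diag l m : (m <= l)%N ->
  legendre_ip l l m = 2 / (2 * l + 1)%N%:R * ((l + m)`!%:R / (l - m)`!%:R).
Proof.
move=> ml; rewrite legendre_ip_fact // mulrC; congr (_ * _).
have := legendre_ip_fact l (leqnn l); rewrite subnn fact0 divr1.
rewrite /legendre_ip legendre_deriv_top mulrAC -mulrA -polyCM mulrC mul_polyC poly_intZ.
rewrite poly_int_one_sub_sqr -/(legendre_ip l l 0) addnn -mul2n factS natrM addn1.
have f0 : (2 * l)`!%:R != 0 :> R by rewrite pnatr_eq0 -lt0n fact_gt0.
have g0 : l`!%:R != 0 :> R by rewrite pnatr_eq0 -lt0n fact_gt0.
have l0 : 0 <= l%:R :> R by rewrite ler0n.
have e0 : 2 ^+ l != 0 :> R by rewrite expf_neq0 // pnatr_eq0.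
move=> h; apply: (mulfI f0); rewrite -h.
by field; rewrite ?f0 ?g0 ?e0 /= ?andbT; apply: lt0r_neq0; lra.
Qed.

Lemma legendre1 l : (P l).[1] = 1.
Proof.
have fn0 n : n`!%:R != 0 :> R by rewrite pnatr_eq0 -lt0n fact_gt0.
(* At [1] the differential equation degenerates to a first-order recurrence between
   consecutive derivatives, which is descended from the constant one of order [l]. *)
suff h m : (m <= l)%N ->
    (P l)^`(l - m).[1] * (2 ^+ (l - m) * (l - m)`!%:R * m`!%:R) = (2 * l - m)`!%:R.
  have := h _ (leqnn l); rewrite subnn mul2n -addnn addnK derivn0 expr0 !mul1r.
  by rewrite -[RHS]mul1r => /(mulIf (fn0 _)).
elim: m => [_|m IH ml].
  have e0 : 2 ^+ l != 0 :> R by rewrite expf_neq0 // pnatr_eq0.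
  by rewrite !subn0 legendre_deriv_top hornerC mulr1 mulfVK // mulf_neq0.
have hn n : (n%:R : {poly R}).[1] = n%:R by rewrite -polyC_natr hornerC.
have h := congr1 (fun p => p.[1]) (legendre_ode l (l - m.+1)).
rewrite !(hornerD, hornerN, hornerM, hornerXn, hornerX, hn, (hn 1%N)) in h.
rewrite !mulr1 subrr mul0r sub0r horner0 -natrB ?leq_subr // subKn // in h.
have e1 : ((l - m.+1).+1 = l - m)%N by lia.
have e2 : (l + (l - m.+1)).+1 = (2 * l - m)%N by lia.
rewrite e1 e2 in h.
have E := IH (ltnW ml).
have e : (2 * l - m = (2 * l - m.+1).+1)%N by lia.
apply: (mulfI (_ : (2 * l - m)%:R != 0)); first by rewrite pnatr_eq0; lia.
rewrite -natrM {2}e -factS -e -E.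
have e' : (l - m = (l - m.+1).+1)%N by lia.
rewrite e' exprS !factS !natrM -e'.
set a := _.[1] in h *; set b := _.[1] in h *.
apply: (@eqr_of_subM _ (2 ^+ (l - m.+1) * (l - m.+1)`!%:R * m`!%:R) _ _ _ _ h).
by rewrite !natrM; ring.
Qed.

End legendre_polynomials.

(** * Square-integrable functions *)

Section square_integrable.
Context d (T : measurableType d) (R : realType).
Variable mu : {measure set T -> \bar R}.
Implicit Types (f g h : T -> R) (a : R).

Definition sqnorm f : \bar R := \int[mu]_x (f x ^+ 2)%:E.

Definition square_integrable f : Prop := measurable_fun setT f /\ (sqnorm f < +oo)%E.

Definition inner_prod f g : R := \int[mu]_x (f x * g x).

Lemma measurable_sqr f : measurable_fun setT f ->
  measurable_fun setT (fun x => (f x ^+ 2)%:E).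
Proof. by move=> mf; apply/measurable_EFinP; exact: measurable_funX. Qed.

Lemma sqnorm_ge0 f : (0 <= sqnorm f)%E.
Proof. by apply: integral_ge0 => x _; rewrite lee_fin sqr_ge0. Qed.

(** The substitute for the triangle inequality: a pointwise inequality between squares is
    integrated, with no condition of finiteness. *)
Lemma le_sqnorm_sum n (c : R) (F : 'I_n -> T -> R) f :
    0 <= c -> measurable_fun setT f -> (forall i, measurable_fun setT (F i)) ->
    (forall x, f x ^+ 2 <= c * \sum_i F i x ^+ 2) ->
  (sqnorm f <= c%:E * \sum_i sqnorm (F i))%E.
Proof.
move=> c0 mf mF le_f; rewrite /sqnorm -ge0_integral_sum //=; last 2 first.
- by move=> i; exact: measurable_sqr.
- by move=> i x _; rewrite lee_fin sqr_ge0.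
have mS : measurable_fun setT (fun x => (\sum_(i < n) (F i x ^+ 2)%:E)%E).
  by apply: emeasurable_sum => i; exact: measurable_sqr.
rewrite -ge0_integralZl_EFin //=; last first.
  by move=> x _; apply: sume_ge0 => i _; rewrite lee_fin sqr_ge0.
apply: ge0_le_integral => //=.
- by move=> x _; rewrite lee_fin sqr_ge0.
- exact: measurable_sqr.
- exact: measurable_funeM.
- by move=> x _; rewrite sumEFin -EFinM lee_fin.
Qed.

Lemma sqr_integrable f : square_integrable f ->
  mu.-integrable setT (EFin \o (fun x => f x ^+ 2)).
Proof.
case=> mf fi; apply/integrableP; split; first exact: measurable_sqr.
by under eq_integral do rewrite /= ger0_norm ?sqr_ge0 //.
Qed.

Lemma integrable_mul f g : square_integrable f -> square_integrable g ->
  mu.-integrable setT (EFin \o (fun x => f x * g x)).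
Proof.
move=> fi gi; have := integrableD measurableT (sqr_integrable fi) (sqr_integrable gi).
apply: le_integrable => //.
  by apply/measurable_EFinP; apply: measurable_funM; [exact: fi.1|exact: gi.1].
move=> x _; rewrite /= lee_fin [leRHS]ger0_norm ?addr_ge0 ?sqr_ge0 //.
by rewrite ler_norml; apply/andP; split; nra.
Qed.

Lemma square_integrableD f g : square_integrable f -> square_integrable g ->
  square_integrable (fun x => f x + g x).
Proof.
move=> fi gi; have mfg : measurable_fun setT (fun x => f x + g x).
  by apply: measurable_funD; [exact: fi.1|exact: gi.1].
split => //.
apply: (@le_lt_trans _ _ (2%:E * \sum_(i < 2) sqnorm (if val i == 0%N then f else g))%E).
  apply: le_sqnorm_sum => //.
    by case=> -[|[|]] //= _; [exact: fi.1|exact: gi.1].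
  move=> x; rewrite !big_ord_recl big_ord0 /=; have := sqr_ge0 (f x - g x); lra.
rewrite !big_ord_recl big_ord0 /= adde0 lte_mul_pinfty ?lee_fin //.
by rewrite lte_add_pinfty ?fi.2 ?gi.2.
Qed.

Lemma square_integrableZ a f : square_integrable f ->
  square_integrable (fun x => a * f x).
Proof.
move=> fi; have mf : measurable_fun setT (fun x => a * f x).
  by apply: measurable_funM => //; exact: fi.1.
split => //.
apply: (@le_lt_trans _ _ ((a ^+ 2)%:E * \sum_(i < 1) sqnorm f)%E).
  apply: le_sqnorm_sum => //; rewrite ?sqr_ge0 //.
    by move=> i; exact: fi.1.
  by move=> x; rewrite big_ord_recl big_ord0 addr0 exprMn.
by rewrite big_ord_recl big_ord0 adde0 lte_mul_pinfty ?lee_fin ?sqr_ge0 // fi.2.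
Qed.

Lemma square_integrable0 : square_integrable (fun=> 0).
Proof.
split; first exact: measurable_cst.
by rewrite /sqnorm integral0_eq ?ltry // => x _; rewrite expr0n.
Qed.

Lemma square_integrable_sum (I : Type) (s : seq I) (F : I -> T -> R) :
    (forall i, square_integrable (F i)) ->
  square_integrable (fun x => \sum_(i <- s) F i x).
Proof.
move=> Fi; elim: s => [|i s IH].
  by under eq_fun do rewrite big_nil; exact: square_integrable0.
by under eq_fun do rewrite big_cons; exact: square_integrableD.
Qed.

Lemma sqnormE f : square_integrable f -> sqnorm f = (inner_prod f f)%:E.
Proof.
move=> [mf fi]; rewrite /inner_prod /Rintegral -[X in fine X]/(sqnorm f) fineK //.
by rewrite ge0_fin_numE // sqnorm_ge0.
Qed.

Lemma inner_prodC f g : inner_prod f g = inner_prod g f.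
Proof. by rewrite /inner_prod; under eq_Rintegral do rewrite mulrC. Qed.

Lemma inner_prodDl f g h :
    square_integrable f -> square_integrable g -> square_integrable h ->
  inner_prod (fun x => f x + g x) h = inner_prod f h + inner_prod g h.
Proof.
move=> fi gi hi; rewrite -RintegralD ?integrable_mul //.
  by apply: eq_Rintegral => x _; rewrite mulrDl.
Qed.

Lemma inner_prodZl a f h : square_integrable f -> square_integrable h ->
  inner_prod (fun x => a * f x) h = a * inner_prod f h.
Proof.
move=> fi hi; rewrite -RintegralZl ?integrable_mul //.
by apply: eq_Rintegral => x _; rewrite mulrA.
Qed.

Lemma inner_prod_suml (I : Type) (s : seq I) (a : I -> R) (F : I -> T -> R) h :
    (forall i, square_integrable (F i)) -> square_integrable h ->
  inner_prod (fun x => \sum_(i <- s) a i * F i x) h = \sum_(i <- s) a i * inner_prod (F i) h.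
Proof.
move=> Fi hi; elim: s => [|i s IH].
  rewrite big_nil /inner_prod; under eq_Rintegral do rewrite big_nil mul0r.
  by rewrite /Rintegral integral0.
rewrite big_cons -IH -inner_prodZl // -inner_prodDl //.
- by congr inner_prod; apply/funext => x; rewrite big_cons.
- exact: square_integrableZ.
- by apply: square_integrable_sum => j; exact: square_integrableZ.
Qed.

Lemma inner_prod_sum (I : Type) (s : seq I) (a : I -> R) (F : I -> T -> R) :
    (forall i, square_integrable (F i)) ->
  sqnorm (fun x => \sum_(i <- s) a i * F i x) =
  (\sum_(i <- s) \sum_(j <- s) a i * a j * inner_prod (F i) (F j))%:E.
Proof.
move=> Fi; have Si : square_integrable (fun x => \sum_(i <- s) a i * F i x).
  by apply: square_integrable_sum => j; exact: square_integrableZ.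
rewrite sqnormE // inner_prod_suml //; congr EFin; apply: eq_bigr => i _.
rewrite inner_prodC inner_prod_suml // mulr_sumr; apply: eq_bigr => j _.
by rewrite mulrA inner_prodC.
Qed.

Section orthonormal.
Variables (I : eqType) (s : seq I) (e : I -> T -> R).
Hypotheses (us : uniq s) (ei : forall i, square_integrable (e i)).
(** Restricted to [s] because [real_sph_harm l m] makes sense for every [m] but is normalized only
    for [|m| <= l]; beyond that it is zero. *)
Hypothesis oe : {in s &, forall i j, inner_prod (e i) (e j) = (i == j)%:R}.

Lemma sqnorm_orthonormal (a : I -> R) :
  sqnorm (fun x => \sum_(i <- s) a i * e i x) = (\sum_(i <- s) a i ^+ 2)%:E.
Proof.
rewrite inner_prod_sum //; congr EFin; apply: eq_big_seq => i si.
rewrite (bigD1_seq i) //= oe // eqxx mulr1 big1_seq ?addr0 // => j /andP[ji sj].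
by rewrite oe // eq_sym (negbTE ji) mulr0.
Qed.

(** The squared norm of [f] minus its projection, here [f + g], is nonnegative. An infinite norm
    makes the claim trivial, so it applies to every sample path of [T0]. *)
Lemma bessel f : measurable_fun setT f ->
  ((\sum_(i <- s) inner_prod f (e i) ^+ 2)%:E <= sqnorm f)%E.
Proof.
move=> mf; have [fy|] := ltP (sqnorm f) +oo%E; last first.
  by rewrite leye_eq => /eqP ->; rewrite leey.
have fi : square_integrable f by [].
rewrite sqnormE // lee_fin.
pose g x := \sum_(i <- s) - inner_prod f (e i) * e i x.
have gi : square_integrable g.
  by apply: square_integrable_sum => j; exact: square_integrableZ.
have fgi : square_integrable (fun x => f x + g x) by exact: square_integrableD.
have := sqnorm_ge0 (fun x => f x + g x); rewrite sqnormE // lee_fin.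
rewrite inner_prodDl // [inner_prod f _]inner_prodC [inner_prod g _]inner_prodC.
rewrite !inner_prodDl // [inner_prod f g]inner_prodC.
have -> : inner_prod g g = \sum_(i <- s) inner_prod f (e i) ^+ 2.
  apply: EFin_inj; rewrite -sqnormE // sqnorm_orthonormal.
  by congr EFin; apply: eq_bigr => i _; rewrite sqrrN.
have -> : inner_prod g f = - \sum_(i <- s) inner_prod f (e i) ^+ 2.
  rewrite inner_prod_suml // -sumrN; apply: eq_bigr => i _.
  by rewrite mulNr expr2 [inner_prod (e i) f]inner_prodC.
by lra.
Qed.

End orthonormal.

End square_integrable.

(** * Increments of fractional Brownian motion *)

(** Convexity of the power: [x + u] and [x + v] are convex combinations of [x] and [x + u + v] with
    exchanged weights, and the two inequalities add up. *)
Lemma powR_superadd_increments (R : realType) (p x u v : R) :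
    1 <= p -> 0 <= x -> 0 <= u -> 0 <= v ->
  (x + u) `^ p + (x + v) `^ p <= (x + u + v) `^ p + x `^ p.
Proof.
move=> p1 x0 u0 v0; have [uv|uv] := eqVneq (u + v) 0.
  have -> : u = 0 by lra.
  by have -> : v = 0; rewrite ?addr0 //; lra.
have {}uv : 0 < u + v by rewrite lt0r uv addr_ge0.
have conv (a b : R) : 0 <= a -> 0 <= b -> a + b = u + v ->
    (x + a) `^ p <= (b / (u + v)) * x `^ p + (a / (u + v)) * (x + u + v) `^ p.
  move=> a0 b0 ab.
  have h0 : 0 <= b / (u + v) by rewrite divr_ge0 // ltW.
  have h1 : b / (u + v) <= 1 by rewrite ler_pdivrMr //; lra.
  have := convex_powR p1 (Itv01 h0 h1) (x := x) (y := x + u + v).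
  rewrite !inE /= !in_itv /= !andbT => /(_ x0); rewrite !convRE /=.
  rewrite [X in X `^ _]convRE /=.
  have -> : unstable.onem (b / (u + v)) = a / (u + v).
    by rewrite /unstable.onem -ab; field; rewrite ab gt_eqF.
  have -> : b / (u + v) * x + a / (u + v) * (x + u + v) = x + a.
    by rewrite -[x + u + v]addrA -ab; field; rewrite ab gt_eqF.
  by apply; rewrite !addr_ge0.
have := conv _ _ u0 v0 erefl; have := conv _ _ v0 u0 (addrC _ _).
have e : u / (u + v) = 1 - v / (u + v) by field; rewrite gt_eqF.
by rewrite e; set r := v / _; lra.
Qed.

Section fractional_brownian_motion.
Context d (Omega : measurableType d) (R : realType).
Variables (P : probability Omega R) (H : R) (b : R -> Omega -> R).
Hypothesis H12 : 2^-1 <= H.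
Hypothesis fb : fBm P H b.

Lemma fBm_measurable s : 0 <= s -> measurable_fun setT (b s).
Proof.
move=> s0; case: fb => /(_ 1%N (fun=> 1) (fun=> s)) [//|mf _] _ _ _.
by move: mf; under eq_fun do rewrite big_ord1 mul1r.
Qed.

Lemma measurable_increment r s : 0 <= r -> 0 <= s ->
  measurable_fun setT (fun w => b s w - b r w).
Proof. by move=> r0 s0; apply: measurable_funB; exact: fBm_measurable. Qed.

Lemma sqnorm_increment r s : 0 <= r -> 0 <= s ->
  sqnorm P (fun w => b s w - b r w) = (`|s - r| `^ (2 * H))%:E.
Proof. by move=> r0 s0; case: fb => _ _ _ /(_ s r s0 r0) <-; rewrite unlock. Qed.

Lemma increment_square_integrable r s : 0 <= r -> 0 <= s ->
  square_integrable P (fun w => b s w - b r w).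
Proof.
by move=> r0 s0; split; [exact: measurable_increment|rewrite sqnorm_increment ?ltry].
Qed.

(** Polarization expresses twice this covariance through variances of increments, as [(u - r)^{2H} -
    (u - s)^{2H} - (t - r)^{2H} + (t - s)^{2H}]. Its sign is that of [powR_superadd_increments] with
    exponent [2 H >= 1]. *)
Lemma inner_prod_increments_ge0 r s t u : 0 <= r -> r <= s -> s <= t -> t <= u ->
  0 <= inner_prod P (fun w => b s w - b r w) (fun w => b u w - b t w).
Proof.
move=> r0 rs st tu.
have [s0 t0 u0] : [/\ 0 <= s, 0 <= t & 0 <= u] by split; lra.
pose D x y : Omega -> R := fun w => b y w - b x w.
have Di x y : 0 <= x -> 0 <= y -> square_integrable P (D x y).
  exact: increment_square_integrable.
have N x y : 0 <= x -> x <= y -> inner_prod P (D x y) (D x y) = (y - x) `^ (2 * H).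
  move=> x0 xy; have y0 : 0 <= y by lra.
  apply: EFin_inj; rewrite -sqnormE; last exact: Di.
  by rewrite (sqnorm_increment x0 y0) ger0_norm ?subr_ge0.
have E x y z : D x z = (fun w => D x y w + D y z w).
  by apply/funext => w; rewrite /D; ring.
have P1 x y z z' v : 0 <= x -> 0 <= y -> 0 <= z -> 0 <= z' -> 0 <= v ->
    inner_prod P (D x z) (D z' v) = inner_prod P (D x y) (D z' v) + inner_prod P (D y z) (D z' v).
  by move=> *; rewrite (E x y z) inner_prodDl //; exact: Di.
have N1 x y z : 0 <= x -> x <= y -> y <= z ->
    (z - x) `^ (2 * H) = (y - x) `^ (2 * H) + (z - y) `^ (2 * H)
      + 2 * inner_prod P (D x y) (D y z).
  move=> x0 xy yz; have [y0 z0] : 0 <= y /\ 0 <= z by split; lra.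
  rewrite -!N //; last by lra.
  rewrite (P1 x y z) // [inner_prod P (D x y) (D x z)]inner_prodC.
  rewrite [inner_prod P (D y z) (D x z)]inner_prodC !(P1 x y z) //.
  by rewrite [inner_prod P (D y z) (D x y)]inner_prodC; ring.
have h1 := N1 _ _ _ r0 rs (le_trans st tu).
have h2 := N1 _ _ _ r0 rs st.
have := P1 s t u r s s0 t0 u0 r0 s0.
rewrite ![inner_prod P _ (D r s)]inner_prodC => h3.
have := @powR_superadd_increments _ (2 * H) (t - s) (s - r) (u - t).
have -> : t - s + (s - r) = t - r by ring.
have -> : t - r + (u - t) = u - r by ring.
have -> : t - s + (u - t) = u - s by ring.
rewrite !subr_ge0 => /(_ _ st rs tu) h4.
have {}h4 := h4 ltac:(move: H12; lra).
by rewrite -/(D r s) -/(D t u); lra.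
Qed.

(* Nonnegative correlations allow every [f i] to be replaced by [M], after which
   the sum telescopes. *)
Lemma le_sqnorm_RS_sum n (s f : nat -> R) (M : R) :
    0 <= s 0%N -> (forall i, (i < n)%N -> s i <= s i.+1) ->
    (forall i, (i < n)%N -> `|f i| <= M) ->
  (sqnorm P (fun w => (\sum_(i < n) f i * (b (s i.+1) w - b (s i) w))%R)
    <= (M ^+ 2 * (s n - s 0%N) `^ (2 * H))%:E)%E.
Proof.
move=> s0 s_nd fM.
have s_mono i j : (i <= j)%N -> (j <= n)%N -> s i <= s j.
  elim: j => [|j IH]; first by rewrite leqn0 => /eqP ->.
  rewrite leq_eqVlt => /orP[/eqP -> //|]; rewrite ltnS => ij jn.
  by rewrite (le_trans (IH ij (ltnW jn))) // s_nd.
have s_ge0 i : (i <= n)%N -> 0 <= s i by move=> i_n; rewrite (le_trans s0) // s_mono.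
pose F (i : 'I_n) w := b (s i.+1) w - b (s i) w.
have Fi i : square_integrable P (F i).
  by apply: increment_square_integrable; apply: s_ge0 => //; rewrite ltnW.
have F_ge0 i j : 0 <= inner_prod P (F i) (F j).
  have [ij|ji|/val_inj ->] := ltngtP i j.
  - by apply: inner_prod_increments_ge0; rewrite ?s_ge0 ?s_nd ?s_mono // ltnW.
  - rewrite inner_prodC; apply: inner_prod_increments_ge0; rewrite ?s_ge0 ?s_nd ?s_mono //.
    by rewrite ltnW.
    by rewrite ltnW.
  - by apply: Rintegral_ge0 => x _; rewrite -expr2 sqr_ge0.
have tele : sqnorm P (fun w => \sum_i 1 * F i w) = ((s n - s 0%N) `^ (2 * H))%:E.
  rewrite -[X in X `^ _]ger0_norm ?subr_ge0 ?s_mono // -sqnorm_increment ?s_ge0 //.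
  congr sqnorm; apply/funext => w; under eq_bigr do rewrite mul1r.
  by rewrite -(big_mkord xpredT (fun i => b (s i.+1) w - b (s i) w)) telescope_sumr.
rewrite (inner_prod_sum _ (fun i : 'I_n => f i) Fi) EFinM -tele.
rewrite (inner_prod_sum _ (fun i : 'I_n => 1) Fi) -EFinM lee_fin mulr_sumr ler_sum // => i _.
rewrite mulr_sumr ler_sum // => j _; rewrite !mul1r ler_wpM2r //.
rewrite (le_trans (ler_norm _)) // normrM expr2 ler_pM //; exact: fM.
Qed.

(** On a common partition through [t], the difference of the two sums is a sum of [g - f] over
    [[0, t]] plus a sum of [g] over [[t, t + h]]. With the two approximation errors this makes four
    terms, hence the factor 4. *)
Lemma sqnorm_RS_integral_diff (f g : R -> R) (t h M N : R) (I J : Omega -> R) :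
    0 <= t -> 0 <= h ->
    (forall s, 0 <= s <= t -> `|g s - f s| <= M) ->
    (forall s, t <= s <= t + h -> `|g s| <= N) ->
    RS_integral P f b 0 t I -> RS_integral P g b 0 (t + h) J ->
  (sqnorm P (fun w => J w - I w)%R <=
    (4 * (M ^+ 2 * t `^ (2 * H) + N ^+ 2 * h `^ (2 * H)))%:E)%E.
Proof.
move=> t0 h0 fgM gN [mI RI] [mJ RJ].
apply/lee_addgt0Pr => e e0.
(* Two approximation errors of [e / 8], each multiplied by 4, add up to [e]. *)
have e8 : 0 < e / 8 by rewrite divr_gt0.
have [d1 d10 {}RI] := RI _ e8; have [d2 d20 {}RJ] := RJ _ e8.
pose dd := Num.min d1 d2; have dd0 : 0 < dd by rewrite lt_min d10.
have [n n0 nd] : exists2 n : nat, 0 < n%:R :> R & forall x, 0 <= x -> x <= t + h -> x / n%:R < dd.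
  exists (Num.truncn ((t + h) / dd)).+1; first by rewrite ltr0n.
  move=> x x0 xth; rewrite ltr_pdivrMr ?ltr0n // mulrC -ltr_pdivrMr //.
  by rewrite (le_lt_trans _ (truncnS_gt _)) // ler_pM2r ?invr_gt0.
(* Both halves have [n] equal steps, so that node [n] is [t]. For [t = 0] the first [n] steps are
   degenerate, which the definition of the integral allows. *)
have [s sL sR] : exists2 s : nat -> R,
    forall i, (i <= n)%N -> s i = t * (i%:R / n%:R) &
    forall i, s (n + i)%N = t + h * (i%:R / n%:R).
  exists (fun i => if (i <= n)%N then t * (i%:R / n%:R) else t + h * ((i - n)%:R / n%:R)) => i.
    by move=> ->.
  rewrite -{2}[n]addn0 leq_add2l leqn0; case: eqP => [->|_].
    by rewrite addn0 mul0r mulr0 addr0 divff ?mulr1 // gt_eqF.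
  by rewrite addKn.
have s0 : s 0%N = 0 by rewrite sL // mul0r mulr0.
have sn : s n = t by rewrite -[n in s n]addn0 sR mul0r mulr0 addr0.
have snn : s (n + n)%N = t + h by rewrite sR divff ?mulr1 // gt_eqF.
have stepL i : (i < n)%N -> s i.+1 - s i = t / n%:R.
  by move=> i_n; rewrite (sL i.+1 i_n) (sL i (ltnW i_n)) -[i.+1%:R]natr1; field; rewrite gt_eqF.
have stepR i : s (n + i).+1 - s (n + i)%N = h / n%:R.
  by rewrite -addnS !sR -[i.+1%:R]natr1; field; rewrite gt_eqF.
have step i : (i < n + n)%N -> s i <= s i.+1 /\ s i.+1 - s i < dd.
  move=> inn; rewrite -subr_ge0; have [i_n|ni] := ltnP i n.
    by rewrite stepL // divr_ge0 ?nd // ?lerDl // ltW.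
  by rewrite -(subnKC ni) stepR divr_ge0 ?nd // ?lerDr // ltW.
have s_mono i j : (i <= j)%N -> (j <= n + n)%N -> s i <= s j.
  elim: j => [|j IH]; first by rewrite leqn0 => /eqP ->.
  rewrite leq_eqVlt => /orP[/eqP -> //|]; rewrite ltnS => ij jn.
  by rewrite (le_trans (IH ij (ltnW jn))) // (step _ jn).1.
(* The second [s] chooses the left endpoints as tags. *)
have {}RI := RI n s s s0 sn _; have {}RJ := RJ (n + n)%N s s s0 snn _.
have dd12 : dd <= d1 /\ dd <= d2 by rewrite /dd !ge_min !lexx orbT.
have {}RI : (sqnorm P (fun w =>
    I w - \sum_(i < n) f (s i) * (b (s i.+1) w - b (s i) w))%R <= (e / 8)%:E)%E.
  have := RI _; rewrite unlock; apply => i i_n.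
  have [h1 h2] := step i (ltn_addr _ i_n); split => //.
  exact: lt_le_trans h2 dd12.1.
have {}RJ : (sqnorm P (fun w =>
    J w - \sum_(i < n + n) g (s i) * (b (s i.+1) w - b (s i) w))%R <= (e / 8)%:E)%E.
  have := RJ _; rewrite unlock; apply => i i_n.
  have [h1 h2] := step i i_n; split => //.
  exact: lt_le_trans h2 dd12.2.
pose SI w := \sum_(i < n) f (s i) * (b (s i.+1) w - b (s i) w).
pose SJ w := \sum_(i < n + n) g (s i) * (b (s i.+1) w - b (s i) w).
pose D1 w := \sum_(i < n) (g (s i) - f (s i)) * (b (s i.+1) w - b (s i) w).
pose D2 w := \sum_(i < n) g (s (n + i)%N) * (b (s (n + i.+1)%N) w - b (s (n + i)%N) w).
have SE w : SJ w - SI w = D1 w + D2 w.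
  rewrite /SJ /SI /D1 /D2 big_split_ord /= addrAC -sumrB; congr (_ + _).
    by apply: eq_bigr => i _; rewrite mulrBl.
  by apply: eq_bigr => i _; rewrite addnS.
have D1b : (sqnorm P D1 <= (M ^+ 2 * t `^ (2 * H))%:E)%E.
  have -> : t = s n - s 0%N by rewrite sn s0 subr0.
  apply: (@le_sqnorm_RS_sum n s (fun i => g (s i) - f (s i))); rewrite ?s0 // => i i_n.
    by rewrite (step _ _).1 // ltn_addr.
  have inn := leq_trans (ltnW i_n) (leq_addr n n).
  apply: (fgM (s i)); apply/andP; split; first by rewrite -s0 s_mono.
  by rewrite -[leRHS]sn s_mono ?leq_addr // ltnW.
have D2b : (sqnorm P D2 <= (N ^+ 2 * h `^ (2 * H))%:E)%E.
  have -> : h = s (n + n)%N - s (n + 0)%N by rewrite snn addn0 sn; ring.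
  apply: (@le_sqnorm_RS_sum n (fun i => s (n + i)%N) (fun i => g (s (n + i)%N))).
  - by rewrite addn0 sn.
  - by move=> i i_n; rewrite addnS (step _ _).1 // ltn_add2l.
  - move=> i i_n; have inn : (n + i <= n + n)%N by rewrite leq_add2l ltnW.
    apply: (gN (s (n + i)%N)); apply/andP; split; last by rewrite -snn s_mono.
    by rewrite -[leLHS]sn s_mono ?leq_addr.
have s_ge0 i : (i <= n + n)%N -> 0 <= s i by move=> h'; rewrite -s0 s_mono.
have mSum k (c : nat -> R) (r : nat -> nat) : (forall i, (i < k)%N -> (r i < n + n)%N) ->
    measurable_fun setT (fun w => \sum_(i < k) c i * (b (s (r i).+1) w - b (s (r i)) w)).
  move=> rk; apply: measurable_sum => i; apply: measurable_funM => //.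
  by apply: measurable_increment; apply: s_ge0; [apply: ltnW|]; apply: rk.
have mSI : measurable_fun setT SI.
  by apply: (mSum n (fun i => f (s i)) id) => i i_n; rewrite ltn_addr.
have mSJ : measurable_fun setT SJ by exact: (mSum (n + n)%N (fun i => g (s i)) id).
have mD1 : measurable_fun setT D1.
  by apply: (mSum n (fun i => g (s i) - f (s i)) id) => i i_n; rewrite ltn_addr.
have mD2 : measurable_fun setT D2.
  rewrite /D2; under eq_fun do under eq_bigr do rewrite addnS.
  by apply: (mSum n (fun i => g (s (n + i)%N)) (fun i => n + i)%N) => i i_n; rewrite ltn_add2l.
pose F (i : 'I_4) : Omega -> R :=
  [:: fun w => J w - SJ w; fun w => I w - SI w; D1; D2]`_i.
apply: (@le_trans _ _ (4%:E * \sum_i sqnorm P (F i))%E).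
  apply: le_sqnorm_sum => //.
  - exact: measurable_funB.
  - case=> [[|[|[|[|k]]]] ki] //; rewrite /F /=; try exact: measurable_funB.
  move=> w; rewrite !big_ord_recl big_ord0 /F /=.
  have := SE w; move: (SJ w) (SI w) (D1 w) (D2 w) => x y z v xy.
  have -> : J w - I w = (J w - x) - (I w - y) + z + v by lra.
  move: (J w - x) (I w - y) => {xy} p q.
  have := sqr_ge0 (p + q); have := sqr_ge0 (p - z); have := sqr_ge0 (p - v).
  have := sqr_ge0 (q + z); have := sqr_ge0 (q + v); have := sqr_ge0 (z - v).
  lra.
rewrite !big_ord_recl big_ord0 /F /= adde0.
apply: (@le_trans _ _ (4%:E * ((e / 8)%:E + ((e / 8)%:E +
    ((M ^+ 2 * t `^ (2 * H))%:E + (N ^+ 2 * h `^ (2 * H))%:E))))%E).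
  by rewrite lee_pmul2l // !leeD.
rewrite -!EFinD -EFinM lee_fin; lra.
Qed.

End fractional_brownian_motion.

(** * Integration on the sphere *)

Section integral_sphere.
Variable R : realType.

Local Notation T2 := (R * R)%type.
Local Notation lambda2 := (lebesgue_measure \x lebesgue_measure)%E.

Definition sph_dens (z : T2) : R := sin z.1 / (4 * pi).

Lemma measurable_angles : measurable (@angles R : set T2).
Proof. by apply: measurableX; exact: measurable_itv. Qed.

Lemma sph_dens_ge0 (z : T2) : angles z -> 0 <= sph_dens z.
Proof.
move=> [/= z1 _]; rewrite divr_ge0 //; first by apply: sin_ge0_pi; rewrite in_itv /= in z1.
by rewrite mulr_ge0 // pi_ge0.
Qed.

Lemma measurable_sph_dens (E : set T2) : measurable_fun E (fun z : T2 => sph_dens z).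
Proof.
apply: (measurable_funS measurableT) => //; apply: measurable_funM => //.
apply: measurableT_comp => //.
exact: (continuous_measurable_fun (@continuous_sin R)).
Qed.

Lemma emeasurable_mul_dens (f : T2 -> \bar R) : measurable_fun setT f ->
  measurable_fun (@angles R) (fun z : T2 => (f z * (sph_dens z)%:E)%E).
Proof.
move=> mf; apply: emeasurable_funM; first exact: (measurable_funS measurableT).
by apply/measurable_EFinP; exact: measurable_sph_dens.
Qed.

Lemma measurable_comp_sph d (T : measurableType d) (f : S2 R -> T) :
  measurable_fun setT f -> measurable_fun setT (fun z : T2 => f (sph z)).
Proof. by move=> mf; exact: (measurableT_comp mf (@measurable_sph R)). Qed.

Import HBNNSimple.

(** [mu_sphere] is given by its values on sets, as the image under [sph] of a density on [angles].
    The change of variables therefore goes through simple functions, then monotone limits, then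
    positive and negative parts. *)
Lemma integral_sphere_nnsfun (f : {nnsfun S2 R >-> R}) :
  (\int[@mu_sphere R]_x (f x)%:E =
   \int[lambda2]_(z in @angles R) ((f (sph z))%:E * (sph_dens z)%:E))%E.
Proof.
have mA : measurable (@angles R : set T2) := measurable_angles.
have mk (k : R) : measurable (f @^-1` [set k]).
  by rewrite -[X in measurable X]setTI; exact: measurable_funP.
have mp (k : R) : measurable (@sph R @^-1` (f @^-1` [set k]) : set T2).
  by rewrite -[X in measurable X]setTI; exact: measurable_sph.
have mi (k : R) : measurable_fun setT (fun z : T2 => (\1_(f @^-1` [set k]) (sph z) : R)%:E).
  by apply/measurable_EFinP; exact: measurable_comp_sph (measurable_indic (mk k)).
under eq_integral do rewrite fimfunE -fsumEFin//.
rewrite ge0_integral_fsum//; last 2 first.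
- by move=> y; exact/measurable_EFinP/measurable_funM.
- by move=> y x _; rewrite nnfun_muleindic_ge0.
transitivity (\int[lambda2]_(z in @angles R)
    \sum_(k \in range f) ((k * \1_(f @^-1` [set k]) (sph z))%:E * (sph_dens z)%:E))%E; last first.
  apply: eq_integral => z _; rewrite [in RHS]fimfunE -fsumEFin // ge0_mule_fsuml //.
  by move=> k; rewrite nnfun_muleindic_ge0.
rewrite ge0_integral_fsum//; last 2 first.
- move=> k; apply: emeasurable_mul_dens; under eq_fun do rewrite EFinM.
  exact: measurable_funeM.
- by move=> k z Dz; apply: mule_ge0; [rewrite nnfun_muleindic_ge0|rewrite lee_fin sph_dens_ge0].
apply: eq_fsbigr => k; rewrite inE => -[x _ <-{k}].
under [in LHS]eq_integral do rewrite EFinM.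
rewrite ge0_integralZl_EFin //; last by apply/measurable_EFinP; exact: measurable_indic.
rewrite integral_indic // setIT.
under [in RHS]eq_integral do rewrite EFinM -muleA.
rewrite ge0_integralZl_EFin //; last 2 first.
- by move=> z Dz; rewrite mule_ge0 ?lee_fin ?sph_dens_ge0.
- exact: emeasurable_mul_dens.
congr (_ * _)%E; rewrite /= /mu_sphere setIC [LHS]integral_mkcondr.
apply: eq_integral => z _; rewrite patchE indicE.
have -> : (sph z \in f @^-1` [set f x]) = (z \in @sph R @^-1` (f @^-1` [set f x])) by [].
by case: ifPn => _; rewrite ?mul1e ?mul0e.
Qed.

Lemma ge0_integral_sphere (f : S2 R -> \bar R) :
    measurable_fun setT f -> (forall x, 0 <= f x)%E ->
  (\int[@mu_sphere R]_x f x =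
   \int[lambda2]_(z in @angles R) (f (sph z) * (sph_dens z)%:E))%E.
Proof.
move=> mf f0; have mA : measurable (@angles R : set T2) := measurable_angles.
pose f_ := nnsfun_approx measurableT mf.
have mfn n : measurable_fun (@angles R) (fun z : T2 => ((f_ n (sph z))%:E * (sph_dens z)%:E)%E).
  apply: emeasurable_mul_dens; apply/measurable_EFinP.
  exact: (measurable_comp_sph (measurable_funPT (f_ n))).
transitivity (lim (\int[@mu_sphere R]_x (f_ n x)%:E @[n --> \oo])%E).
  rewrite -monotone_convergence//=.
  - apply: eq_integral => ? /[!inE] xD; apply/esym/cvg_lim => //=.
    exact: cvg_nnsfun_approx.
  - by move=> n; exact/measurable_EFinP/measurable_funTS.
  - by move=> n ? _; rewrite lee_fin.
  - by move=> ? _ ? ? mn; rewrite lee_fin; exact/lefP/nd_nnsfun_approx.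
rewrite [RHS](_ : _ = lim
    (\int[lambda2]_(z in @angles R) ((f_ n (sph z))%:E * (sph_dens z)%:E)
      @[n --> \oo])%E); last first.
  rewrite -monotone_convergence//=.
  - apply: eq_integral => z /[!inE] Dz; apply/esym/cvg_lim => //.
    rewrite muleC; under eq_fun do rewrite muleC.
    apply: cvgeZl => //; exact: cvg_nnsfun_approx.
  - by move=> n z Dz; rewrite mule_ge0 ?lee_fin ?sph_dens_ge0.
  - move=> z Dz m n mn; rewrite lee_wpmul2r ?lee_fin ?sph_dens_ge0 //.
    exact/lefP/nd_nnsfun_approx.
by apply: congr_lim; apply/funext => n /=; exact: integral_sphere_nnsfun.
Qed.

Lemma integral_sphere_sph (f : S2 R -> \bar R) : measurable_fun setT f ->
  (\int[@mu_sphere R]_x f x =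
   \int[lambda2]_(z in @angles R) (f (sph z) * (sph_dens z)%:E))%E.
Proof.
move=> mf; rewrite [LHS]integralE [RHS]integralE.
rewrite !ge0_integral_sphere //; [|exact: measurable_funeneg|exact: measurable_funepos].
congr (_ - _)%E; apply: eq_integral => z /[!inE] /sph_dens_ge0 h.
  by rewrite !funeposE maxeMl ?lee_fin // mul0e.
by rewrite !funenegE -mulNe maxeMl ?lee_fin // mul0e.
Qed.

End integral_sphere.

(** * One-dimensional integrals and product integrands *)

Section interval_integrals.
Variable R : realType.
Local Notation lambda := (@lebesgue_measure R).

Lemma continuous_itv_integrable (f : R -> R) (a b : R) : continuous f ->
  lambda.-integrable `[a, b] (EFin \o f).
Proof.
move=> cf; apply: continuous_compact_integrable; first exact: segment_compact.
exact: continuous_subspaceT.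
Qed.

Lemma Rintegral_is_derive (F f : R -> R) (a b : R) : a < b -> continuous f ->
  (forall x : R, is_derive x 1 F (f x)) -> \int[lambda]_(x in `[a, b]) f x = F b - F a.
Proof.
move=> ab cf dF; rewrite /Rintegral (@continuous_FTC2 _ f F) //.
- exact: continuous_subspaceT.
- have cF : continuous F.
    by move=> x; apply: differentiable_continuous; apply/derivable1_diffP; exact: ex_derive.
  split; [by move=> x _; exact: ex_derive| |].
  + by apply: cvg_at_right_filter; exact: cF.
  + by apply: cvg_at_left_filter; exact: cF.
- by move=> x _; rewrite derive1E; exact: derive_val.
Qed.

(** The substitution [s = cos x], carried out by exhibiting the primitive [- (poly_prim
    p).[cos x]]. *)
Lemma Rintegral_poly_cos_sin (p : {poly R}) :
  \int[lambda]_(x in `[0, pi]) (p.[cos x] * sin x) = poly_int p.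
Proof.
have dF (x : R) : is_derive x 1 (fun x => - (poly_prim p).[cos x]) (p.[cos x] * sin x).
  have dp (y : R) : is_derive y 1 (horner (poly_prim p)) p.[y].
    rewrite -[in p.[y]](deriv_poly_prim p) derive.derivE derive1E.
    by apply: derivableP; exact: derivable_horner.
  have -> : p.[cos x] * sin x = - (p.[cos x] * - sin x) by ring.
  by apply: is_deriveN; apply: (@is_derive1_comp _ (horner (poly_prim p)) cos).
have cf : continuous (fun x : R => p.[cos x] * sin x).
  move=> x; apply: cvgM; last exact: continuous_sin.
  by apply: continuous_comp; [exact: continuous_cos|exact: continuous_horner].
by rewrite (Rintegral_is_derive (pi_gt0 R) cf dF) cos0 cospi /poly_int; ring.
Qed.

Lemma Rintegral_cos_affine (c e : R) : c != 0 ->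
  \int[lambda]_(x in `[0, 2 * pi]) cos (c * x + e) = (sin (c * (2 * pi) + e) - sin e) / c.
Proof.
move=> c0; have pi2 : 0 < 2 * pi :> R by rewrite mulr_gt0 // pi_gt0.
have dF (x : R) : is_derive x 1 (fun x => c^-1 * sin (c * x + e)) (cos (c * x + e)).
  apply: is_derive_eq.
  by rewrite /GRing.scale /=; field.
have cf : continuous (fun x : R => cos (c * x + e)).
  move=> x; apply: continuous_comp; last exact: continuous_cos.
  by apply: cvgD; [apply: cvgM; [exact: cvg_cst|exact: cvg_id]|exact: cvg_cst].
by rewrite (Rintegral_is_derive pi2 cf dF) mulr0 add0r; field.
Qed.

Lemma sin_periodz (z : int) (x : R) : sin (z%:~R * (2 * pi) + x) = sin x.
Proof.
have pn n y : sin (n%:R * (2 * pi) + y) = sin y :> R.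
  elim: n => [|n IH]; first by rewrite mul0r add0r.
  have -> : n.+1%:R * (2 * pi) + y = n%:R * (2 * pi) + y + pi *+ 2 by rewrite -natr1; ring.
  by rewrite sinD2pi IH.
case: z => n; first exact: pn.
by rewrite NegzE -(pn n.+1 (_ * _ + x)); congr sin; rewrite mulrNz -pmulrn; ring.
Qed.

(** The phase [e] lets the formula cover sines as well; the frequency is an integer of any sign
    because it will be a sum or difference of [|m|] and [|m'|]. *)
Lemma Rintegral_cosz (z : int) (e : R) :
  \int[lambda]_(x in `[0, 2 * pi]) cos (z%:~R * x + e) = if z == 0 then 2 * pi * cos e else 0.
Proof.
case: eqVneq => [->|z0]; last first.
  by rewrite Rintegral_cos_affine ?intr_eq0 // sin_periodz subrr mul0r.
under eq_Rintegral do rewrite mul0r add0r.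
rewrite Rintegral_cst //= lebesgue_measure_itv /= lte_fin mulr_gt0 ?pi_gt0 //.
by rewrite oppr0 addr0 /= mulrC.
Qed.

Lemma integral_prod_mul (A B : set R) (f g : R -> R) : measurable A -> measurable B ->
    lambda.-integrable A (EFin \o f) -> lambda.-integrable B (EFin \o g) ->
  (\int[lambda \x lambda]_(z in A `*` B) (f z.1 * g z.2)%:E)%E =
  (\int[lambda]_(x in A) f x * \int[lambda]_(x in B) g x)%:E.
Proof.
move=> mA mB fA gB.
have fi : lambda.-integrable setT (EFin \o (f \_ A)).
  rewrite -restrict_EFin.
  by have [h _] := @integrable_mkcond _ _ R lambda A (EFin \o f) mA; exact: h.
have gi : lambda.-integrable setT (EFin \o (g \_ B)).
  rewrite -restrict_EFin.
  by have [h _] := @integrable_mkcond _ _ R lambda B (EFin \o g) mB; exact: h.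
rewrite [X in (X * _)%:E]Rintegral_mkcond [X in (_ * X)%:E]Rintegral_mkcond [LHS]integral_mkcond.
(* The indicator of a rectangle is a product of indicators, so restricting each factor reduces the
   claim to the whole plane. *)
have -> : ((fun z : R * R => (f z.1 * g z.2)%:E) \_ (A `*` B)) =
          (fun z => ((f \_ A) z.1 * (g \_ B) z.2)%:E).
  apply/funext => z; rewrite !patchE in_setX.
  by case: (z.1 \in A); case: (z.2 \in B); rewrite ?mul0r ?mulr0.
move: (f \_ A) (g \_ B) fi gi => f' g' fi gi.
have mf : measurable_fun setT f' by apply/measurable_EFinP; exact: measurable_int fi.
have mg : measurable_fun setT g' by apply/measurable_EFinP; exact: measurable_int gi.
have inner x : (\int[lambda]_y (f' x * g' y)%:E = (f' x * \int[lambda]_y g' y)%:E)%E.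
  under eq_integral do rewrite EFinM.
  by rewrite integralZl // EFinM /Rintegral fineK // integrable_fin_num.
have mfg : measurable_fun setT (fun z : R * R => (f' z.1 * g' z.2)%:E).
  by apply/measurable_EFinP; apply: measurable_funM; apply: measurableT_comp.
rewrite -integral12_prod_meas1 /=.
  rewrite /fubini_F; under eq_integral do rewrite inner EFinM.
  rewrite integralZr // [RHS]EFinM; congr (_ * _)%E.
  by rewrite /Rintegral fineK // integrable_fin_num.
apply/integrable12ltyP => //=.
under eq_integral do under eq_integral do rewrite normrM EFinM.
have /integrableP[_ gy] := gi; have /integrableP[_ fy] := fi.
have ig : (\int[lambda]_y `|g' y|%:E)%E \is a fin_num.
  by rewrite ge0_fin_numE //; apply: integral_ge0 => y _; rewrite lee_fin.
under eq_integral => x _.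
  rewrite ge0_integralZl_EFin //; last first.
    by apply/measurable_EFinP; exact: measurableT_comp.
  rewrite -(fineK ig) muleC.
  over.
rewrite ge0_integralZl_EFin //; last 2 first.
- by apply/measurable_EFinP; exact: measurableT_comp.
- by rewrite fine_ge0 //; apply: integral_ge0 => y _; rewrite lee_fin.
rewrite lte_mul_pinfty //.
by rewrite lee_fin fine_ge0 //; apply: integral_ge0 => y _; rewrite lee_fin.
Qed.

End interval_integrals.

(** * Real spherical harmonics *)

Section real_spherical_harmonics.
Variable R : realType.
Implicit Types (l k : nat) (m : int) (x : S2 R).
Local Notation lambda := (@lebesgue_measure R).

Let cx x := sval x 0 0.
Let cy x := sval x 1 0.
Let cz x := sval x (inord 2) 0.

Lemma dotS_self x : dotS x x = 1.
Proof. by have /eqP <- := svalP x; apply: eq_bigr => i _; rewrite expr2. Qed.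

Lemma S2_sqr_sum x : cx x ^+ 2 + cy x ^+ 2 + cz x ^+ 2 = 1.
Proof.
have /eqP <- := svalP x; rewrite !big_ord_recl big_ord0 addr0 addrA /cx /cy /cz.
congr (_ + _ + _); congr (sval x _ _ ^+ 2); apply: val_inj => //=.
by rewrite inordK.
Qed.

Lemma sqr_cz_le1 x : cz x ^+ 2 <= 1.
Proof. by have := S2_sqr_sum x; have := sqr_ge0 (cx x); have := sqr_ge0 (cy x); lra. Qed.

Lemma cos_colatitude x : cos (colatitude x) = cz x.
Proof.
rewrite /colatitude acosK // in_itv /=; have := sqr_cz_le1 x.
rewrite -/(cz x); move: (cz x) => z z1; apply/andP; split; nra.
Qed.

Let rho x := Num.sqrt (cx x ^+ 2 + cy x ^+ 2).

(** At the poles [rho] is zero, so the value chosen for [longitude] there is immaterial. Elsewhere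
    the sign of the second coordinate selects [acos] or its reflection. *)
Lemma rho_longitude x : rho x * cos (longitude x) = cx x /\ rho x * sin (longitude x) = cy x.
Proof.
rewrite /longitude -/(cx x) -/(cy x) -/(rho x).
have s0 : 0 <= cx x ^+ 2 + cy x ^+ 2 by rewrite addr_ge0 ?sqr_ge0.
have r2 : rho x ^+ 2 = cx x ^+ 2 + cy x ^+ 2 by rewrite sqr_sqrtr.
have [r0|r0] := eqVneq (rho x) 0.
  move: r2; rewrite r0 !mul0r expr0n /= => /esym/eqP.
  by rewrite paddr_eq0 ?sqr_ge0 // !sqrf_eq0 => /andP[/eqP -> /eqP ->].
have rp : 0 < rho x by rewrite lt0r r0 sqrtr_ge0.
set u := cx x / rho x.
have u2 : 1 - u ^+ 2 = (cy x / rho x) ^+ 2.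
  by rewrite /u !expr_div_n r2; field; rewrite -r2 expf_neq0.
have u1 : -1 <= u <= 1.
  have : u ^+ 2 <= 1 by rewrite -subr_ge0 u2 sqr_ge0.
  by move=> ule; apply/andP; split; nra.
have cu : cos (acos u) = u by rewrite acosK // in_itv.
have su : sin (acos u) = `|cy x| / rho x.
  by rewrite sin_acos // u2 sqrtr_sqr normrM [`|_^-1|]ger0_norm // invr_ge0 ltW.
have [y0|y0] := leP 0 (cy x).
  by rewrite cu su ger0_norm // /u; split; field.
have e2 : 2 * pi = pi *+ 2 :> R by rewrite mulr_natl.
rewrite e2 addrC cosD2pi sinD2pi cosN sinN cu su ltr0_norm // /u.
by split; field.
Qed.

Lemma sqrt_sub_sqr_cz x : Num.sqrt (1 - cz x ^+ 2) = rho x.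
Proof. by rewrite /rho -(S2_sqr_sum x); congr Num.sqrt; ring. Qed.

Lemma de_moivre (a : R) k : (cos a +i* sin a) ^+ k = cos (k%:R * a) +i* sin (k%:R * a).
Proof.
elim: k => [|k IH]; first by rewrite mul0r cos0 sin0.
rewrite exprS IH -natr1 mulrDl mul1r cosD sinD; apply/eqP; rewrite eq_complex /=.
by apply/andP; split; apply/eqP; ring.
Qed.

Definition sph_harm_norm l k : R := Num.sqrt ((2 * l + 1)%N%:R * (l - k)`!%:R / (l + k)`!%:R).

(** In Cartesian coordinates [(x + i y)^k] absorbs both [sin^k theta] and [e^{i k phi}], and a
    polynomial remains. Measurability follows, and composition with [sph] requires no inversion of
    the spherical coordinates. *)
Lemma sph_harm_nonnegE l k x :
  sph_harm_nonneg l k x =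
  (sph_harm_norm l k * (-1) ^+ k * (legendre R l)^`(k).[cz x])%:C * (cx x +i* cy x) ^+ k.
Proof.
have [<- <-] := rho_longitude x.
have -> : (rho x * cos (longitude x) +i* (rho x * sin (longitude x))) =
    (rho x)%:C * (cos (longitude x) +i* sin (longitude x)).
  by apply/eqP; rewrite eq_complex /= !mul0r subr0 addr0 !eqxx.
rewrite exprMn de_moivre /sph_harm_nonneg /assoc_legendre cos_colatitude sqrt_sub_sqr_cz.
rewrite [RHS]mulrA; congr (_ * _); rewrite -rmorphXn -[RHS]rmorphM /=.
by rewrite -/(sph_harm_norm l k); congr (_ +i* _); ring.
Qed.

(** The sign of [m] selects the real or the imaginary part, so the real basis has the same indices
    as the complex one; [Negz k] is the order [-(k + 1)]. *)
Definition real_sph_harm l m x : R :=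
  match m with
  | Posz 0 => complex.Re (sph_harm_nonneg l 0 x)
  | Posz k => Num.sqrt 2 * complex.Re (sph_harm_nonneg l k x)
  | Negz k => Num.sqrt 2 * complex.Im (sph_harm_nonneg l k.+1 x)
  end.

Lemma measurable_coords : measurable_fun setT (@coords R).
Proof. by move=> _ B mB; rewrite setTI; exists B => //; rewrite setTI. Qed.

Lemma measurable_cx : measurable_fun setT cx.
Proof.
have h : measurable_fun setT (fun p : R * R * R => p.1.1).
  exact: (measurableT_comp measurable_fst measurable_fst).
exact: (measurableT_comp h measurable_coords).
Qed.

Lemma measurable_cy : measurable_fun setT cy.
Proof.
have h : measurable_fun setT (fun p : R * R * R => p.1.2).
  exact: (measurableT_comp measurable_snd measurable_fst).
exact: (measurableT_comp h measurable_coords).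
Qed.

Lemma measurable_cz : measurable_fun setT cz.
Proof.
have h : measurable_fun setT (fun p : R * R * R => p.2) := measurable_snd.
exact: (measurableT_comp h measurable_coords).
Qed.

Lemma measurable_sph_harm_nonneg l k :
  measurable_fun setT (fun x => complex.Re (sph_harm_nonneg l k x)) /\
  measurable_fun setT (fun x => complex.Im (sph_harm_nonneg l k x)).
Proof.
have [mr mi] : measurable_fun setT (fun x => complex.Re ((cx x +i* cy x) ^+ k)) /\
    measurable_fun setT (fun x => complex.Im ((cx x +i* cy x) ^+ k)).
  elim: k => [|k [IHr IHi]]; first by split; exact: measurable_cst.
  have cxp : measurable_fun setT (fun x => cx x) := measurable_cx.
  have cyp : measurable_fun setT (fun x => cy x) := measurable_cy.
  have ReM (a b : R[i]) : complex.Re (a * b) =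
      complex.Re a * complex.Re b - complex.Im a * complex.Im b.
    by case: a b => [? ?] [? ?].
  have ImM (a b : R[i]) : complex.Im (a * b) =
      complex.Re a * complex.Im b + complex.Im a * complex.Re b.
    by case: a b => [? ?] [? ?].
  split; under eq_fun do rewrite exprS ?ReM ?ImM /=.
    by apply: measurable_funB; exact: measurable_funM.
  by apply: measurable_funD; exact: measurable_funM.
have mP : measurable_fun setT (fun x => sph_harm_norm l k * (-1) ^+ k * (legendre R l)^`(k).[cz x]).
  apply: measurable_funM => //.
  apply: (measurableT_comp _ measurable_cz).
  by apply: continuous_measurable_fun => y; exact: continuous_horner.
split.
  have -> : (fun x => complex.Re (sph_harm_nonneg l k x)) = (fun x =>
      sph_harm_norm l k * (-1) ^+ k * (legendre R l)^`(k).[cz x] *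
      complex.Re ((cx x +i* cy x) ^+ k)).
    apply/funext => x; rewrite sph_harm_nonnegE.
    by case: ((_ +i* _) ^+ k) => a b /=; rewrite mul0r subr0.
  exact: measurable_funM.
have -> : (fun x => complex.Im (sph_harm_nonneg l k x)) = (fun x =>
    sph_harm_norm l k * (-1) ^+ k * (legendre R l)^`(k).[cz x] * complex.Im ((cx x +i* cy x) ^+ k)).
  apply/funext => x; rewrite sph_harm_nonnegE.
    by case: ((_ +i* _) ^+ k) => a b /=; rewrite mul0r addr0.
exact: measurable_funM.
Qed.

Lemma measurable_real_sph_harm l m : measurable_fun setT (real_sph_harm l m).
Proof.
have Re k := (measurable_sph_harm_nonneg l k).1.
have Im k := (measurable_sph_harm_nonneg l k).2.
by case: m => [[|k]|k]; rewrite /real_sph_harm //; apply: measurable_funM.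
Qed.

Definition theta_part l k (th : R) : R :=
  sph_harm_norm l k * (-1) ^+ k * (legendre R l)^`(k).[cos th] * sin th ^+ k.

(* [sin (k ph)] is written [cos (k ph - pi / 2)], so that both signs of [m] are
   covered by one formula. *)
Definition phi_part m (ph : R) : R :=
  (if m == 0 then 1 else Num.sqrt 2) *
  cos (`|m|%N%:R * ph + (if m is Negz _ then - (pi / 2) else 0)).

Lemma real_sph_harm_sph l m (z : R * R) :
  real_sph_harm l m (sph z) = theta_part l `|m| z.1 * phi_part m z.2.
Proof.
have E k : sph_harm_nonneg l k (sph z) =
    (theta_part l k z.1)%:C * (cos (k%:R * z.2) +i* sin (k%:R * z.2)).
  rewrite sph_harm_nonnegE.
  have -> : cz (sph z) = cos z.1 by rewrite /cz /= mxE inordK.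
  have -> : cx (sph z) +i* cy (sph z) = (sin z.1)%:C * (cos z.2 +i* sin z.2).
    rewrite /cx /cy /= !mxE /=.
    by apply/eqP; rewrite eq_complex /= !mul0r subr0 addr0 !eqxx.
  by rewrite exprMn de_moivre mulrA -rmorphXn -rmorphM.
case: m => [[|k]|k]; rewrite /real_sph_harm E /phi_part /= ?mul0r ?subr0 ?addr0 ?mul1r //.
- by ring.
- by rewrite cosBpihalf; ring.
Qed.

Lemma continuous_cos_affine (c e : R) : continuous (fun x : R => cos (c * x + e)).
Proof.
move=> x; apply: continuous_comp; last exact: continuous_cos.
by apply: cvgD; [apply: cvgM; [exact: cvg_cst|exact: cvg_id]|exact: cvg_cst].
Qed.

Lemma continuous_phi_part m : continuous (phi_part m).
Proof. by move=> x; apply: cvgM; [exact: cvg_cst|exact: continuous_cos_affine]. Qed.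

Lemma continuous_theta_part l k : continuous (theta_part l k).
Proof.
move=> x; apply: cvgM; last first.
  apply: (@continuous_comp _ _ _ sin (fun y : R => y ^+ k)); first exact: continuous_sin.
  exact: exprn_continuous.
apply: cvgM; first exact: cvg_cst.
by apply: continuous_comp; [exact: continuous_cos|exact: continuous_horner].
Qed.

(** The product of cosines becomes a sum of cosines of frequencies [|m| - |m'|] and [|m| + |m'|],
    and only a zero frequency contributes. The weight [sqrt 2] compensates for the missing second
    contribution when [m] is not zero. *)
Lemma phi_part_orthogonal m m' :
  \int[lambda]_(x in `[0, 2 * pi]) (phi_part m x * phi_part m' x) = 2 * pi * (m == m')%:R.
Proof.
pose d (n : int) : R := if n is Negz _ then - (pi / 2) else 0.
pose w (n : int) : R := if n == 0 then 1 else Num.sqrt 2.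
pose zm : int := `|m|%N%:Z - `|m'|%N%:Z; pose zp : int := `|m|%N%:Z + `|m'|%N%:Z.
pose cm (x : R) : R := cos (zm%:~R * x + (d m - d m')).
pose cp (x : R) : R := cos (zp%:~R * x + (d m + d m')).
have E (x : R) : phi_part m x * phi_part m' x = w m * w m' / 2 * (cm x + cp x).
  rewrite /phi_part -/(d m) -/(d m') -/(w m) -/(w m') /cm /cp.
  set a := `|m|%N%:R * x + d m; set b := `|m'|%N%:R * x + d m'.
  have -> : zm%:~R * x + (d m - d m') = a - b by rewrite /zm rmorphB /= /a /b; ring.
  have -> : zp%:~R * x + (d m + d m') = a + b by rewrite /zp rmorphD /= /a /b; ring.
  by rewrite (cosB a b) (cosD a b); field.
have icm : lambda.-integrable `[0, 2 * pi] (EFin \o cm).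
  by apply: continuous_itv_integrable; exact: continuous_cos_affine.
have icp : lambda.-integrable `[0, 2 * pi] (EFin \o cp).
  by apply: continuous_itv_integrable; exact: continuous_cos_affine.
under eq_Rintegral do rewrite E.
rewrite RintegralZl //; last first.
  by apply: continuous_itv_integrable => x; apply: cvgD; exact: continuous_cos_affine.
rewrite RintegralD // !Rintegral_cosz.
have s2 : Num.sqrt 2 * Num.sqrt 2 = 2 :> R by rewrite -expr2 sqr_sqrtr.
have [mm1|mm'] := eqVneq m m'.
  rewrite /zm /zp -mm1 !subrr eqxx cos0 /w.
  have [->|m0] := eqVneq m 0; first by rewrite /= addr0 cos0; field.
  have -> : (`|m|%N%:Z + `|m|%N%:Z == 0) = false by apply/negbTE; move/eqP: m0; lia.
  by rewrite s2 addr0 ?eqxx /=; field.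
rewrite mulr0; apply/eqP; rewrite mulf_eq0; apply/orP; right; apply/eqP.
have -> : (zp == 0) = false by apply/negbTE; move/eqP: mm'; rewrite /zp; lia.
rewrite addr0; case: ifPn => // /eqP; rewrite /zm => h.
(* Here the orders are opposite and nonzero, so the phases differ by a quarter period. *)
have -> : cos (d m - d m') = 0; last by rewrite mulr0.
case: m m' mm' h {E icm icp cm cp zm zp} => [k|k] [k'|k'] mm' h; rewrite /d.
- by move/eqP: mm'; lia.
- by rewrite sub0r opprK cos_pihalf.
- by rewrite subr0 cosN cos_pihalf.
- by move/eqP: mm'; lia.
Qed.

Lemma integral_real_sph_harm l m l' m' :
  (\int[@mu_sphere R]_x (real_sph_harm l m x * real_sph_harm l' m' x)%:E)%E =
  (\int[lambda]_(th in `[0, pi])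
     ((4 * pi)^-1 * (theta_part l `|m| th * theta_part l' `|m'| th * sin th)) *
   (2 * pi * (m == m')%:R))%:E.
Proof.
rewrite integral_sphere_sph; last first.
  by apply/measurable_EFinP; apply: measurable_funM; exact: measurable_real_sph_harm.
rewrite -phi_part_orthogonal -integral_prod_mul //; first last.
- apply: continuous_itv_integrable => x; apply: cvgM; exact: continuous_phi_part.
- apply: continuous_itv_integrable => x; apply: cvgM; first exact: cvg_cst.
  apply: cvgM; last exact: continuous_sin.
  by apply: cvgM; exact: continuous_theta_part.
apply: eq_integral => z _; rewrite !real_sph_harm_sph -EFinM /sph_dens; congr EFin.
by ring.
Qed.

Lemma real_sph_harm_square_integrable l m : square_integrable (@mu_sphere R) (real_sph_harm l m).
Proof.
split; first exact: measurable_real_sph_harm.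
(* The square is unfolded to a product; the integral is then given by a real number, hence
   finite. *)
by rewrite /sqnorm -[X in (X < _)%E]/(\int[_]_x (_ x * _ x)%:E)%E integral_real_sph_harm ltry.
Qed.

Lemma inner_prod_real_sph_harm l m l' m' : (`|m| <= l)%N -> (`|m'| <= l')%N ->
  inner_prod (@mu_sphere R) (real_sph_harm l m) (real_sph_harm l' m') =
  ((l, m) == (l', m'))%:R.
Proof.
move=> ml ml'; rewrite /inner_prod /Rintegral integral_real_sph_harm /=.
rewrite xpair_eqE; have [mm'|mm'] := eqVneq m m'; last by rewrite andbF !mulr0.
rewrite andbT mulr1; move: ml'; rewrite -mm'; move: (`|m|%N) ml => {m m' mm'} k kl kl'.
pose p := (1 - 'X^2) ^+ k * (legendre R l)^`(k) * (legendre R l')^`(k).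
(* The two factors [sin th ^+ k] form the weight [(1 - s^2)^k] at [s = cos th], and the two signs
   [(-1) ^+ k] cancel. *)
have E th : (4 * pi)^-1 * (theta_part l k th * theta_part l' k th * sin th) =
    (4 * pi)^-1 * (sph_harm_norm l k * sph_harm_norm l' k) * (p.[cos th] * sin th).
  have -> : p.[cos th] = sin th ^+ k * sin th ^+ k *
      (legendre R l)^`(k).[cos th] * (legendre R l')^`(k).[cos th].
    rewrite /p !hornerM horner_exp hornerD hornerN hornerXn -polyC1 hornerC -sin2cos2.
    by rewrite -exprM mulnC exprM expr2.
  have ss : (-1) ^+ k * (-1) ^+ k = 1 :> R by rewrite -exprMn mulrNN mulr1 expr1n.
  rewrite /theta_part; move: ((-1) ^+ k) ss => s ss.
  rewrite -[RHS]mul1r -ss; move: (_.[cos th]) (_.[cos th]) => u v; ring.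
under eq_Rintegral do rewrite E.
rewrite RintegralZl //; last first.
  apply: continuous_itv_integrable => x; apply: cvgM; last exact: continuous_sin.
  by apply: continuous_comp; [exact: continuous_cos|exact: continuous_horner].
rewrite Rintegral_poly_cos_sin -/(legendre_ip R l l' k).
have [<-|ll'] := eqVneq l l'; last by rewrite legendre_ip_orth // mulr0 mul0r.
rewrite legendre_ip_diag // -expr2 sqr_sqrtr; last by rewrite !mulr_ge0 // invr_ge0.
have pi0 : pi != 0 :> R by rewrite gt_eqF ?pi_gt0.
have f1 : (l - k)`!%:R != 0 :> R by rewrite pnatr_eq0 -lt0n fact_gt0.
have f2 : (l + k)`!%:R != 0 :> R by rewrite pnatr_eq0 -lt0n fact_gt0.
have f3 : 2 * l%:R + 1 != 0 :> R by rewrite lt0r_neq0 // ltr_wpDl // mulr_ge0.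
by rewrite /=; move: pi pi0 => q q0; field; rewrite f1 f2 f3 q0.
Qed.

(** The harmonic of degree 0 is the constant 1, and its squared norm is already known. *)
Lemma mu_sphere1 : @mu_sphere R setT = 1%E.
Proof.
have E x : real_sph_harm 0 0 x = 1.
  rewrite /real_sph_harm sph_harm_nonnegE /sph_harm_norm /= expr0 mulr1.
  rewrite /legendre /= expr0 mul1r invr1 scale1r.
  have -> : (('X^2 - 1) ^+ 0 : {poly R}).[cz x] = 1 by rewrite expr0 -polyC1 hornerC.
  by rewrite fact0 !mulr1 sqrtr1 mulr0 subr0.
have := sqnormE (real_sph_harm_square_integrable 0 0).
rewrite inner_prod_real_sph_harm // eqxx /= /sqnorm.
under eq_integral do rewrite E expr1n.
by rewrite integral_cst // mul1e.
Qed.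

End real_spherical_harmonics.

HB.instance Definition _ (R : realType) :=
  Measure_isProbability.Build _ _ _ (@mu_sphere R) (@mu_sphere1 R).

(** * Expansion in real spherical harmonics *)

(** Orders are paired as [m] and [-m], since only such a pair of complex harmonics has a real
    contribution; [Negz j] is the opposite of [j.+1]. *)
Lemma big_ord_int_sym (V : nmodType) (F : int -> V) (l : nat) :
  \sum_(k < (2 * l).+1) F (k%:Z - l%:Z) = F 0 + \sum_(j < l) (F j.+1%:Z + F (Negz j)).
Proof.
elim: l => [|l IH]; first by rewrite muln0 big_ord1 big_ord0 addr0 /= addr0.
rewrite mulnS big_ord_recl big_ord_recr /= [in RHS]big_ord_recr /= [RHS]addrA -IH.
have -> : 0%:Z - l.+1%:Z = Negz l by rewrite NegzE sub0r.
have -> : (bump 0 (2 * l).+1)%:Z - l.+1%:Z = l.+1%:Z by rewrite /bump /=; lia.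
rewrite addrC -addrA; congr (_ + _).
by apply: eq_bigr => i _; congr F; rewrite /bump /=; lia.
Qed.

(* [fine] sends the infinite or undefined integral of a non-integrable function
   to [0], so that scaling requires no integrability. *)
Lemma RintegralZ d (T : measurableType d) (R : realType) (mu : {measure set T -> \bar R})
    (f : T -> R) (c : R) : measurable_fun setT f ->
  \int[mu]_x (c * f x) = c * \int[mu]_x f x.
Proof.
move=> mf; have nint g : measurable_fun setT g -> ~ mu.-integrable setT (EFin \o g) ->
    \int[mu]_x g x = 0.
  move=> mg ng; rewrite /Rintegral; case: (boolP ((\int[mu]_x (g x)%:E)%E \is a fin_num)).
    rewrite integralE fin_numB => /andP[p n]; exfalso; apply: ng.
    apply/integrableP; split; first exact/measurable_EFinP.
    have mge : measurable_fun setT (EFin \o g) by exact/measurable_EFinP.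
    have -> : (fun x => `|(EFin \o g) x|)%E = ((EFin \o g)^\+ \+ (EFin \o g)^\-)%E.
      by rewrite -fune_abse.
    rewrite ge0_integralD //; last 2 first.
    - exact: measurable_funepos.
    - exact: measurable_funeneg.
    by rewrite lte_add_pinfty // ltey_eq ?p ?n.
  by case: (\int[mu]_x _)%E.
have [->|c0] := eqVneq c 0.
  by rewrite mul0r; under eq_Rintegral do rewrite mul0r; rewrite /Rintegral integral0.
have [fi|nf] := pselect (mu.-integrable setT (EFin \o f)); first exact: RintegralZl.
rewrite !nint ?mulr0 //; first exact: measurable_funM.
move=> h; apply: nf.
have := integrableZl measurableT c^-1 h; apply: eq_integrable => // x _ /=.
by rewrite -EFinM mulKf.
Qed.

Section expansion.
Variable R : realType.
Local Notation mu := (@mu_sphere R).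
Implicit Types (l k : nat) (m : int) (x : S2 R) (f : S2 R -> R).

Lemma Im_sph_harm0 l x : complex.Im (sph_harm_nonneg l 0 x) = 0.
Proof. by rewrite sph_harm_nonnegE expr0 /= mul0r mulr0 addr0. Qed.

Lemma fourier_coefE f l k : measurable_fun setT f ->
  fourier_coef f l k =
  (\int[mu]_x (f x * complex.Re (sph_harm_nonneg l k x))) +i*
  (- \int[mu]_x (f x * complex.Im (sph_harm_nonneg l k x))).
Proof.
move=> mf; have [mr mi] := measurable_sph_harm_nonneg R l k.
rewrite /fourier_coef /integral_sphere -mulN1r -RintegralZ; last exact: measurable_funM.
by congr (_ +i* _); apply: eq_Rintegral => x _ /=; case: (sph_harm_nonneg l k x) => a b /=; ring.
Qed.

Lemma fourier_coefNE f l k : measurable_fun setT f ->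
  fourier_coef f l (Negz k) = ((-1) ^+ k.+1)%:C *
  (\int[mu]_x (f x * complex.Re (sph_harm_nonneg l k.+1 x)) +i*
   \int[mu]_x (f x * complex.Im (sph_harm_nonneg l k.+1 x))).
Proof.
move=> mf; have [mr mi] := measurable_sph_harm_nonneg R l k.+1.
have E (s a b : R) : s%:C * (a +i* b) = (s * a) +i* (s * b).
  by apply/eqP; rewrite eq_complex /= !mul0r subr0 addr0 !eqxx.
rewrite E -!RintegralZ; [|exact: measurable_funM..].
have S : (-1) ^+ k.+1 = ((-1) ^+ k.+1)%:C :> R[i] by rewrite rmorphXn rmorphN1.
rewrite /fourier_coef /integral_sphere /= S.
by congr (_ +i* _); apply: eq_Rintegral => x _ /=; case: (sph_harm_nonneg l k.+1 x) => a b /=; ring.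
Qed.

(** For real [f] the terms of orders [m] and [-m] are conjugate, so their imaginary parts cancel and
    their sum is twice a real part, which [sqrt 2 * sqrt 2] matches. Integrability is avoided
    through [RintegralZ], so the identity holds for every sample path. *)
Lemma fourier_expansion f l x : measurable_fun setT f ->
  \sum_(k < (2 * l).+1) fourier_coef f l (k%:Z - l%:Z) * sph_harm l (k%:Z - l%:Z) x =
  (\sum_(k < (2 * l).+1) inner_prod mu f (real_sph_harm l (k%:Z - l%:Z)) *
     real_sph_harm l (k%:Z - l%:Z) x)%:C.
Proof.
move=> mf.
rewrite (big_ord_int_sym (fun m => fourier_coef f l m * sph_harm l m x)).
rewrite (big_ord_int_sym (fun m => inner_prod mu f (real_sph_harm l m) * real_sph_harm l m x)).
rewrite rmorphD rmorph_sum; congr (_ + _).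
  rewrite (fourier_coefE l 0) //; have := Im_sph_harm0 l x.
  have -> : \int[mu]_x0 (f x0 * complex.Im (sph_harm_nonneg l 0 x0)) = 0.
    under eq_Rintegral do rewrite Im_sph_harm0 mulr0.
    by rewrite /Rintegral integral0.
  have -> : sph_harm l 0 x = sph_harm_nonneg l 0 x by [].
  rewrite /inner_prod /real_sph_harm.
  move: (\int[mu]_y (f y * complex.Re (sph_harm_nonneg l 0 y))) => c.
  case: (sph_harm_nonneg l 0 x) => a b /= ->.
  apply/eqP; rewrite eq_complex /=; apply/andP; split; apply/eqP; ring.
apply: eq_bigr => j _; rewrite fourier_coefE // fourier_coefNE //.
have -> : sph_harm l j.+1 x = sph_harm_nonneg l j.+1 x by [].
have -> : sph_harm l (Negz j) x = (-1) ^+ j.+1 * conjc (sph_harm_nonneg l j.+1 x) by [].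
have [mr mi] := measurable_sph_harm_nonneg R l j.+1.
have IZ (g : S2 R -> R) : measurable_fun setT g ->
    inner_prod mu f (fun y => Num.sqrt 2 * g y) = Num.sqrt 2 * \int[mu]_y (f y * g y).
  move=> mg; rewrite -RintegralZ; last exact: measurable_funM.
  by apply: eq_Rintegral => y _; rewrite mulrCA.
rewrite [X in inner_prod _ _ X * _ + _]/real_sph_harm [X in _ + inner_prod _ _ X * _]/real_sph_harm.
rewrite /real_sph_harm !IZ //.
have S : (-1) ^+ j.+1 = ((-1) ^+ j.+1)%:C :> R[i] by rewrite rmorphXn rmorphN1.
have ss : (-1) ^+ j.+1 * (-1) ^+ j.+1 = 1 :> R by rewrite -exprMn mulrNN mulr1 expr1n.
rewrite S; move: ((-1) ^+ j.+1) ss => s ss {S}.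
have s2 : Num.sqrt 2 * Num.sqrt 2 = 2 :> R by rewrite -expr2 sqr_sqrtr.
move: (\int[mu]_y _) (\int[mu]_y _) (Num.sqrt 2) s2 => b a c cc.
case: (sph_harm_nonneg l j.+1 x) => p q /=.
apply/eqP; rewrite eq_complex /=; apply/andP; split; apply/eqP.
- transitivity ((1 + s * s) * (a * p + b * q)); first by ring.
  rewrite ss; transitivity ((c * c) * (a * p + b * q)); last by ring.
  by rewrite cc.
- by transitivity ((1 - s * s) * (a * q - b * p)); [ring|rewrite ss subrr mul0r].
Qed.

Context d (Omega : measurableType d).
Variables (alpha gamma t0 : R) (A : R^nat) (T0 : S2 R -> Omega -> R).
Variables I1 I2 : nat -> nat -> R -> Omega -> R.
Local Notation psil l := (psi alpha gamma (eigval R l)).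

(** Follows the sign convention of [real_sph_harm]: the first family multiplies real parts, the
    second imaginary parts. *)
Definition noise_coef l m t w : R :=
  match m with Posz k => I1 l k t w | Negz k => I2 l k.+1 t w end.

Definition KL_coef (i : nat * int) t w : R :=
  expR (- psil i.1 * (t + t0)) * inner_prod mu (T0^~ w) (real_sph_harm i.1 i.2)
    + Num.sqrt (A i.1) * noise_coef i.1 i.2 t w.

Definition KL_index (n : nat) : seq (nat * int) :=
  [seq (l, k%:Z - l%:Z) | l <- iota 0 n, k <- iota 0 (2 * l).+1].

Lemma KL_index_uniq n : uniq (KL_index n).
Proof.
apply: allpairs_uniq_dep; [exact: iota_uniq|by move=> *; exact: iota_uniq|].
by move=> [l k] [l' k'] _ _ /= [-> h]; congr (existT _ _ _); lia.
Qed.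

Lemma KL_index_le n i : i \in KL_index n -> (`|i.2| <= i.1)%N.
Proof.
move=> /allpairsPdep[l [k [_]]]; rewrite mem_iota /= => kl -> /=.
by lia.
Qed.

Lemma sum_KL_index (V : nmodType) (F : nat * int -> V) n :
  \sum_(i <- KL_index n) F i = \sum_(l < n) \sum_(k < (2 * l).+1) F (l : nat, k%:Z - l%:Z).
Proof.
rewrite big_allpairs_dep -(big_mkord xpredT (fun l => \sum_(k < (2 * l).+1) F (l, k%:Z - l%:Z))).
rewrite /index_iota subn0; apply: eq_bigr => l _.
by rewrite -(big_mkord xpredT (fun k => F (l, k%:Z - l%:Z))) /index_iota subn0.
Qed.

Lemma KL_partial_sumE n t w x : measurable_fun setT (T0^~ w) ->
  \sum_(l < n) (initial_term alpha gamma t0 T0 l t w x + noise_term A I1 I2 l t w x) =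
  (\sum_(i <- KL_index n) KL_coef i t w * real_sph_harm i.1 i.2 x)%:C.
Proof.
move=> mT; rewrite sum_KL_index rmorph_sum; apply: eq_bigr => l _.
rewrite /KL_coef /=; under [in RHS]eq_bigr do rewrite mulrDl -!mulrA.
rewrite big_split rmorphD /= -!mulr_sumr; congr (_ + _).
  rewrite /initial_term; under eq_bigr do rewrite -mulrA.
  by rewrite -mulr_sumr fourier_expansion // -rmorphM.
rewrite (big_ord_int_sym (fun m => noise_coef l m t w * real_sph_harm l m x)).
rewrite /noise_term [RHS]rmorphM; congr (_ * _).
rewrite [RHS]rmorphD; congr (_ + _).
  have -> : sph_harm l 0 x = sph_harm_nonneg l 0 x by [].
  have -> : real_sph_harm l 0 x = complex.Re (sph_harm_nonneg l 0 x) by [].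
  have := Im_sph_harm0 l x; case: (sph_harm_nonneg l 0 x) => a b /= ->.
  by apply/eqP; rewrite eq_complex /=; apply/andP; split; apply/eqP; ring.
rewrite big_add1 big_mkord -rmorph_sum -rmorphM mulr_sumr /=; congr (_ +i* _).
apply: eq_bigr => j _; rewrite /real_sph_harm /=; ring.
Qed.

End expansion.

(** * Second moments on the product space *)

(** The factor [expR (- a)] is kept for two different uses: the noise bounds it by 1, the initial
    field combines it with [mulr_expRN_le]. *)
Lemma expRN_sub_le (R : realType) (a b : R) : 0 <= b ->
  `|expR (- (a + b)) - expR (- a)| <= b * expR (- a).
Proof.
move=> b0; rewrite opprD expRD -[X in _ - X]mulr1 -mulrBr normrM mulrC.
rewrite [`|expR _|]ger0_norm ?expR_ge0 // ler_wpM2r ?expR_ge0 //.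
have h1 : expR (- b) <= 1 by rewrite expR_le1 oppr_le0.
by rewrite ler0_norm ?subr_le0 //; have := expR_ge1Dx (- b); lra.
Qed.

Lemma mulr_expRN_le (R : realType) (a : R) : a * expR (- a) <= 1.
Proof.
by rewrite expRN ler_pdivrMr ?expR_gt0 // mul1r; have := expR_ge1Dx a; lra.
Qed.

Lemma powR_sqr (R : realType) (x p : R) : x `^ (2 * p) = (x `^ p) ^+ 2.
Proof. by rewrite mulrC powRrM powR_mulrn // powR_ge0. Qed.

Lemma psi_ge0 (R : realType) (alpha gamma s : R) : 0 <= psi alpha gamma s.
Proof. by rewrite /psi mulr_ge0 // powR_ge0. Qed.

Section product_space.
Context d (Omega : measurableType d) (R : realType) (P : probability Omega R).
Local Notation mu := (@mu_sphere R).
Local Notation PM := (P \x @mu_sphere R)%E.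

Lemma sqnorm_prod (f : Omega * S2 R -> R) : measurable_fun setT f ->
  sqnorm PM f = (\int[P]_w sqnorm mu (fun x => f (w, x)))%E.
Proof.
move=> mf; rewrite /sqnorm fubini_tonelli1 //; first exact: measurable_sqr.
by move=> z; rewrite lee_fin sqr_ge0.
Qed.

Lemma measurable_sqnorm_section (f : Omega * S2 R -> R) : measurable_fun setT f ->
  measurable_fun setT (fun w => sqnorm mu (fun x => f (w, x))).
Proof.
move=> mf; apply: (measurable_fun_fubini_tonelli_F (fun z => (f z ^+ 2)%:E)).
- exact: measurable_sqr.
- by move=> z; rewrite lee_fin sqr_ge0.
Qed.

(** Integrability of the sections is not known, so Tonelli's theorem is applied to the positive and
    negative parts, which [integralE] recombines. *)
Lemma measurable_inner_prod_section (f : Omega * S2 R -> R) (g : S2 R -> R) :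
    measurable_fun setT f -> measurable_fun setT g ->
  measurable_fun setT (fun w => inner_prod mu (fun x => f (w, x)) g).
Proof.
move=> mf mg; have mF : measurable_fun setT (fun z : Omega * S2 R => (f z * g z.2)%:E).
  apply/measurable_EFinP; apply: measurable_funM => //.
  exact: (measurableT_comp mg measurable_snd).
pose F (z : Omega * S2 R) := (f z * g z.2)%:E.
have mI : measurable_fun setT (fun w => \int[mu]_x F (w, x))%E.
  under eq_fun do rewrite integralE.
  apply: emeasurable_funB.
    have h := measurable_fun_fubini_tonelli_F (m2 := mu) (F^\+)%E (measurable_funepos mF).
    apply: (eq_measurable_fun (fubini_F mu (F^\+)%E)); last first.
      by apply: h => z; rewrite funeposE le_max lexx orbT.
    by move=> w _; apply: eq_integral => x _; rewrite !funeposE.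
  have h := measurable_fun_fubini_tonelli_F (m2 := mu) (F^\-)%E (measurable_funeneg mF).
  apply: (eq_measurable_fun (fubini_F mu (F^\-)%E)); last first.
    by apply: h => z; rewrite funenegE le_max lexx orbT.
  by move=> w _; apply: eq_integral => x _; rewrite !funenegE.
exact: (measurableT_comp (fine_measurable measurableT) mI).
Qed.

Definition sqL2 (Z : Omega -> S2 R -> R[i]) : \bar R :=
  (\int[P]_w \int[mu]_x (complex.Re (Z w x) ^+ 2 + complex.Im (Z w x) ^+ 2)%:E)%E.

Lemma sqL2E (Z : Omega -> S2 R -> R[i]) :
    measurable_fun setT (fun z : Omega * S2 R => complex.Re (Z z.1 z.2)) ->
    measurable_fun setT (fun z : Omega * S2 R => complex.Im (Z z.1 z.2)) ->
  sqL2 Z = (sqnorm PM (fun z => complex.Re (Z z.1 z.2)) +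
            sqnorm PM (fun z => complex.Im (Z z.1 z.2)))%E.
Proof.
move=> mr mi; rewrite /sqnorm -ge0_integralD //; first last.
- exact: measurable_sqr.
- by move=> z _; rewrite lee_fin sqr_ge0.
- exact: measurable_sqr.
- by move=> z _; rewrite lee_fin sqr_ge0.
rewrite fubini_tonelli1 //.
- by apply: emeasurable_funD; exact: measurable_sqr.
- by move=> z; rewrite adde_ge0 // lee_fin sqr_ge0.
Qed.

Lemma sqL2_ge0 Z : (0 <= sqL2 Z)%E.
Proof.
apply: integral_ge0 => w _; apply: integral_ge0 => x _.
by rewrite lee_fin addr_ge0 ?sqr_ge0.
Qed.

Lemma sqL2_le_of_L2norm_lt (Z : Omega -> S2 R -> R[i]) (e : R) : 0 < e ->
  (L2norm P Z < e%:E)%E -> (sqL2 Z <= (e ^+ 2)%:E)%E.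
Proof.
move=> e0; rewrite /L2norm -/(sqL2 Z); have := sqL2_ge0 Z.
case: (sqL2 Z) => [r| |] //; last by rewrite poweRyr ?invr_neq0 ?pnatr_eq0.
rewrite lee_fin => r0; rewrite poweR_EFin powR12_sqrt // lte_fin lee_fin => h.
by rewrite -(sqr_sqrtr r0); apply: lerXn2r; rewrite ?nnegrE ?sqrtr_ge0 ?ltW.
Qed.

Lemma L2norm_le_of_sqL2 (Z : Omega -> S2 R -> R[i]) (K y : R) : 0 < y ->
  (sqL2 Z <= (K * y ^+ 2)%:E)%E -> (L2norm P Z <= (Num.sqrt K * y)%:E)%E.
Proof.
move=> y0; rewrite /L2norm -/(sqL2 Z); have := sqL2_ge0 Z.
case: (sqL2 Z) => [r| |] //; rewrite !lee_fin => r0 rK.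
have K0 : 0 <= K by rewrite -(pmulr_lge0 _ (exprn_gt0 2 y0)) (le_trans r0).
rewrite /= powR12_sqrt // (le_trans (ler_wsqrtr rK)) //.
by rewrite sqrtrM // sqrtr_sqr ger0_norm // ltW.
Qed.

(** [U] and [V] will be truncation errors at two times and [D] the increment of the partial sums,
    which is real and thus enters the real part only. *)
Lemma sqL2_le3 (Z U V : Omega -> S2 R -> R[i]) (D : Omega * S2 R -> R) :
    measurable_fun setT (fun z : Omega * S2 R => complex.Re (U z.1 z.2)) ->
    measurable_fun setT (fun z : Omega * S2 R => complex.Im (U z.1 z.2)) ->
    measurable_fun setT (fun z : Omega * S2 R => complex.Re (V z.1 z.2)) ->
    measurable_fun setT (fun z : Omega * S2 R => complex.Im (V z.1 z.2)) ->
    measurable_fun setT D ->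
    (forall w x, Z w x = U w x - V w x + (D (w, x))%:C) ->
  (sqL2 Z <= 3%:E * (sqL2 U + (sqL2 V + sqnorm PM D)))%E.
Proof.
move=> mUr mUi mVr mVi mD ZE.
have rZ : (fun z : Omega * S2 R => complex.Re (Z z.1 z.2)) =
    (fun z => complex.Re (U z.1 z.2) - complex.Re (V z.1 z.2) + D z).
  apply/funext => -[w x]; rewrite ZE /=.
  by case: (U w x) (V w x) => [a b] [a' b'].
have iZ : (fun z : Omega * S2 R => complex.Im (Z z.1 z.2)) =
    (fun z => complex.Im (U z.1 z.2) - complex.Im (V z.1 z.2)).
  apply/funext => -[w x]; rewrite ZE /=.
  by case: (U w x) (V w x) => [a b] [a' b'] /=; rewrite addr0.
have mZr : measurable_fun setT (fun z : Omega * S2 R => complex.Re (Z z.1 z.2)).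
  by rewrite rZ; apply: measurable_funD => //; exact: measurable_funB.
have mZi : measurable_fun setT (fun z : Omega * S2 R => complex.Im (Z z.1 z.2)).
  by rewrite iZ; exact: measurable_funB.
rewrite !sqL2E //.
pose Fr (i : 'I_3) : Omega * S2 R -> R :=
  [:: fun z => complex.Re (U z.1 z.2); fun z => complex.Re (V z.1 z.2); D]`_i.
pose Fi (i : 'I_2) : Omega * S2 R -> R :=
  [:: fun z => complex.Im (U z.1 z.2); fun z => complex.Im (V z.1 z.2)]`_i.
have hr : (sqnorm PM (fun z => complex.Re (Z z.1 z.2)) <= 3%:E * \sum_i sqnorm PM (Fr i))%E.
  apply: le_sqnorm_sum => //.
    by case=> [[|[|[|k]]] ki].
  move=> z; rewrite [X in X ^+ 2 <= _](congr1 (fun f => f z) rZ) !big_ord_recl big_ord0 /Fr /=.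
  move: (complex.Re (U _ _)) (complex.Re (V _ _)) (D z) => a b c.
  by have := sqr_ge0 (a + b); have := sqr_ge0 (a - c); have := sqr_ge0 (b + c); lra.
have hi : (sqnorm PM (fun z => complex.Im (Z z.1 z.2)) <= 3%:E * \sum_i sqnorm PM (Fi i))%E.
  apply: le_sqnorm_sum => //.
    by case=> [[|[|k]] ki].
  move=> z; rewrite [X in X ^+ 2 <= _](congr1 (fun f => f z) iZ) !big_ord_recl big_ord0 /Fi /=.
  move: (complex.Im (U _ _)) (complex.Im (V _ _)) => a b.
  by have := sqr_ge0 (a + b); have := sqr_ge0 a; have := sqr_ge0 b; lra.
apply: (le_trans (leeD hr hi)); rewrite !big_ord_recl !big_ord0 /Fr /Fi /= !adde0.
have AC (a b c e f : \bar R) : (0 <= a -> 0 <= b -> 0 <= c -> 0 <= e -> 0 <= f ->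
    3%:E * (a + (b + f)) + 3%:E * (c + e) = 3%:E * (a + c + (b + e + f)))%E.
  move=> a0 b0 c0 e0 f0; rewrite -ge0_muleDr ?adde_ge0 // addeACA.
  by rewrite [(b + f + e)%E]addeAC.
by rewrite AC // ?sqnorm_ge0.
Qed.

End product_space.

(** * Increments of the coefficients and of the partial sums *)

Section increments.
Context d (Omega : measurableType d) (R : realType) (P : probability Omega R).
Local Notation mu := (@mu_sphere R).
Local Notation PM := (P \x @mu_sphere R)%E.
Variables (alpha gamma t0 H : R) (A : R^nat) (T0 : S2 R -> Omega -> R).
Variables beta1 beta2 I1 I2 : nat -> nat -> R -> Omega -> R.
Local Notation psil l := (psi alpha gamma (eigval R l)).
Local Notation e := (@real_sph_harm R).
Hypothesis H12 : 2^-1 <= H < 1.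
Hypothesis hbeta : fBm_components P H beta1 beta2.
Hypothesis hI1 : OU_integrals P alpha gamma 0 beta1 I1.
Hypothesis hI2 : OU_integrals P alpha gamma 1 beta2 I2.
Hypothesis mT0 : measurable_fun setT (fun z : Omega * S2 R => T0 z.2 z.1).

Lemma sqnorm_OU_increment (c t h : R) (b : R -> Omega -> R) (I J : Omega -> R) :
    0 <= c -> 0 <= t -> 0 < h <= 1 -> fBm P H b ->
    RS_integral P (fun s => expR (- c * (t - s))) b 0 t I ->
    RS_integral P (fun s => expR (- c * (t + h - s))) b 0 (t + h) J ->
  (sqnorm P (fun w => J w - I w)%R <=
   (4 * (Num.max 1 t) ^+ 2 * (1 + c) ^+ 2 * (h `^ H) ^+ 2)%:E)%E.
Proof.
move=> c0 t0' /andP[h0 h1] fb RI RJ; have /andP[H1 H2] := H12.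
have := sqnorm_RS_integral_diff H1 fb (M := c * h) (N := 1) t0' (ltW h0) _ _ RI RJ.
move=> /(_ _ _)/le_trans; apply.
- move=> s /andP[s0 st].
  have -> : - c * (t + h - s) = - (c * (t - s) + c * h) by ring.
  have -> : - c * (t - s) = - (c * (t - s)) by ring.
  have ch : 0 <= c * h by rewrite mulr_ge0 // ltW.
  rewrite (le_trans (expRN_sub_le _ ch)) // ler_piMr // expR_le1 oppr_le0.
  by rewrite mulr_ge0 // subr_ge0.
- move=> s /andP[st sth]; rewrite ger0_norm ?expR_ge0 // expR_le1 mulNr oppr_le0.
  by rewrite mulr_ge0 // subr_ge0.
rewrite lee_fin expr1n mul1r exprMn !powR_sqr.
(* Frees the constant from [H]: [t^H <= T] because [T >= 1] and [H < 1], while [h <= h^H] because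
   [h <= 1]. *)
set T := Num.max 1 t.
have T1 : 1 <= T by rewrite le_max lexx.
have [Tge0 H0] : 0 <= T /\ 0 <= H by split; lra.
have tT : (t `^ H) ^+ 2 <= T ^+ 2.
  rewrite lerXn2r ?nnegrE ?powR_ge0 // (@le_trans _ _ (T `^ H)) //.
    by apply: ge0_ler_powR; rewrite ?nnegrE // le_max lexx orbT.
  by rewrite ler1_powR // ltW.
have hh : h ^+ 2 <= (h `^ H) ^+ 2.
  rewrite lerXn2r ?nnegrE ?powR_ge0 ?(ltW h0) //.
  by apply: ger1_powR; rewrite ?h0 ?h1 // ltW.
move: hh tT; move: (h ^+ 2) (sqr_ge0 h) ((h `^ H) ^+ 2) (sqr_ge0 (h `^ H)) => q q0 r r0 qr.
move: ((t `^ H) ^+ 2) (sqr_ge0 (t `^ H)) => u u0 uT.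
have T2 : 1 <= T ^+ 2 by rewrite -[1](expr1n _ 2) lerXn2r ?nnegrE.
have h2 : c ^+ 2 * q * u <= c ^+ 2 * r * T ^+ 2.
  by rewrite ler_pM // ?mulr_ge0 ?sqr_ge0 // ler_wpM2l ?sqr_ge0.
have h3 : r <= T ^+ 2 * r by rewrite ler_peMl.
have h4 : 0 <= 2 * c * (T ^+ 2 * r) by rewrite !mulr_ge0 // ?sqr_ge0.
have -> : 4 * T ^+ 2 * (1 + c) ^+ 2 * r =
    4 * (T ^+ 2 * r + 2 * c * (T ^+ 2 * r) + c ^+ 2 * r * T ^+ 2) by ring.
by rewrite ler_pM2l //; lra.
Qed.

Lemma noise_coef_measurable l m t : (`|m| <= l)%N -> 0 <= t ->
  measurable_fun setT (noise_coef I1 I2 l m t).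
Proof.
case: m => k kl t0'; rewrite /noise_coef.
  by have [] := hI1 (l := l) (m := k) (t := t) kl t0'.
by have [] := hI2 (l := l) (m := k.+1) (t := t) kl t0'.
Qed.

Lemma sqnorm_noise_coef_increment l m (t h : R) : (`|m| <= l)%N -> 0 <= t -> 0 < h <= 1 ->
  (sqnorm P (fun w => noise_coef I1 I2 l m (t + h) w - noise_coef I1 I2 l m t w)%R <=
   (4 * (Num.max 1 t) ^+ 2 * (1 + psil l) ^+ 2 * (h `^ H) ^+ 2)%:E)%E.
Proof.
move=> ml t0' hh; have th0 : 0 <= t + h by case/andP: hh; lra.
case: hbeta => f1 f2 _; case: m ml => k kl; rewrite /noise_coef.
  apply: (@sqnorm_OU_increment _ _ _ (beta1 l k)) => //; rewrite ?psi_ge0 //.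
  - exact: f1.
  - exact: hI1.
  - exact: hI1.
apply: (@sqnorm_OU_increment _ _ _ (beta2 l k.+1)) => //; rewrite ?psi_ge0 //.
- exact: f2.
- exact: hI2.
- exact: hI2.
Qed.

(** The bound [psi_l h e^{-psi_l (t + t0)}] equals [h / (t + t0)] times [x e^{-x}] at
    [x = psi_l (t + t0)], so [l] disappears. *)
Lemma initial_coef_increment l (t h : R) : 0 < t + t0 -> 0 <= h ->
  `|expR (- psil l * (t + h + t0)) - expR (- psil l * (t + t0))| <= h / (t + t0).
Proof.
move=> tt h0; have p0 := psi_ge0 alpha gamma (eigval R l).
have -> : - psil l * (t + h + t0) = - (psil l * (t + t0) + psil l * h) by ring.
have ph : 0 <= psil l * h by rewrite mulr_ge0.
rewrite mulNr (le_trans (expRN_sub_le _ ph)) //.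
rewrite ler_pdivlMr //.
have := mulr_expRN_le (psil l * (t + t0)) => /(ler_wpM2l h0).
by rewrite mulr1; apply: le_trans; rewrite le_eqVlt; apply/orP; left; apply/eqP; ring.
Qed.

Definition KL_increment n (t h : R) (z : Omega * S2 R) : R :=
  \sum_(i <- KL_index n)
    (KL_coef alpha gamma t0 A T0 I1 I2 i (t + h) z.1 - KL_coef alpha gamma t0 A T0 I1 I2 i t z.1)
    * e i.1 i.2 z.2.

Lemma KL_coef_measurable i t : (`|i.2| <= i.1)%N -> 0 <= t ->
  measurable_fun setT (KL_coef alpha gamma t0 A T0 I1 I2 i t).
Proof.
move=> il t0'; apply: measurable_funD; apply: measurable_funM => //.
  exact: (measurable_inner_prod_section mT0 (@measurable_real_sph_harm R i.1 i.2)).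
exact: noise_coef_measurable.
Qed.

Lemma measurable_KL_sum n (a : nat * int -> Omega -> R) :
    (forall i, (`|i.2| <= i.1)%N -> measurable_fun setT (a i)) ->
  measurable_fun setT (fun z : Omega * S2 R => \sum_(i <- KL_index n) a i z.1 * e i.1 i.2 z.2).
Proof.
move=> ma.
(* Coefficients outside [|m| <= l] are replaced by zero, since [measurable_sum] asks for
   measurability at every index. *)
have -> : (fun z : Omega * S2 R => \sum_(i <- KL_index n) a i z.1 * e i.1 i.2 z.2) =
    (fun z => \sum_(i <- KL_index n)
       (if (`|i.2| <= i.1)%N then a i else cst 0) z.1 * e i.1 i.2 z.2).
  by apply/funext => z; apply: eq_big_seq => i /KL_index_le ->.
apply: measurable_sum => i; apply: measurable_funM; last first.
  exact: (measurableT_comp (@measurable_real_sph_harm R i.1 i.2) measurable_snd).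
case: ifPn => [/ma h|_]; last exact: measurable_cst.
exact: (measurableT_comp h measurable_fst).
Qed.

Lemma measurable_KL_increment n t h : 0 <= t -> 0 <= h ->
  measurable_fun setT (KL_increment n t h).
Proof.
move=> t0' h0; apply: (@measurable_KL_sum n (fun i w =>
  KL_coef alpha gamma t0 A T0 I1 I2 i (t + h) w
    - KL_coef alpha gamma t0 A T0 I1 I2 i t w)) => i il.
by apply: measurable_funB; apply: KL_coef_measurable; rewrite ?addr_ge0.
Qed.

(** By Tonelli's theorem the second moment, the same at every point, is averaged over a sphere of
    total mass 1. *)
Lemma sqnorm_initial_field (c : R) :
    (forall x, 'E_P[(fun w => T0 x w * T0 x w)%R] = c%:E)%E ->
  (\int[P]_w sqnorm mu (T0^~ w) = c%:E)%E.
Proof.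
move=> ET; rewrite /sqnorm.
rewrite (fubini_tonelli (m1 := P) (m2 := mu) (fun z => (T0 z.2 z.1 ^+ 2)%:E)) /=; last 2 first.
- exact: measurable_sqr.
- by move=> z; rewrite lee_fin sqr_ge0.
under eq_integral => x _ do
  (rewrite (_ : \int[P]_w _ = c%:E)%E;
   last by rewrite -(ET x) unlock; apply: eq_integral => w _; rewrite expr2).
by rewrite integral_cst // [X in (_ * X)%E]mu_sphere1 mule1.
Qed.

(** For fixed [w], orthonormality turns the norm over the sphere into a sum of squares, each split
    into initial and noise parts at the cost of a factor 2; Bessel's inequality bounds the initial
    parts. Only then is the expectation taken. The bound does not depend on [n]. *)
Lemma sqnorm_KL_increment n (t h c q : R) :
    0 <= t -> 0 < h <= 1 -> 0 < t + t0 -> h / (t + t0) <= h `^ H -> (forall l, 0 <= A l) ->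
    (forall x, 'E_P[(fun w => T0 x w * T0 x w)%R] = c%:E)%E ->
    \sum_(l < n) (2 * l + 1)%N%:R * ((1 + psil l) ^+ 2 * A l) <= q ->
  (sqnorm PM (KL_increment n t h) <=
    (2 * (c + 4 * (Num.max 1 t) ^+ 2 * q) * (h `^ H) ^+ 2)%:E)%E.
Proof.
move=> t0' h01 tt hH A0 ET qle.
have h0 : 0 <= h by case/andP: h01; lra.
rewrite sqnorm_prod; last exact: measurable_KL_increment.
have oe : {in KL_index n &, forall i j, inner_prod mu (e i.1 i.2) (e j.1 j.2) = (i == j)%:R}.
  move=> [l m] [l' m'] /KL_index_le il /KL_index_le jl.
  by rewrite inner_prod_real_sph_harm.
have ei (i : nat * int) : square_integrable mu (e i.1 i.2).
  exact: real_sph_harm_square_integrable.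
pose dn i w := noise_coef I1 I2 i.1 i.2 (t + h) w - noise_coef I1 I2 i.1 i.2 t w.
pose ip (i : nat * int) w := inner_prod mu (T0^~ w) (e i.1 i.2).
pose a := (h `^ H) ^+ 2.
have mdn (i : nat * int) : (`|i.2| <= i.1)%N -> measurable_fun setT (dn i).
  by move=> il; apply: measurable_funB; apply: noise_coef_measurable; rewrite ?addr_ge0.
(* As in [measurable_KL_sum], zero outside the admissible orders to make every term measurable. *)
pose dn' (i : nat * int) := if (`|i.2| <= i.1)%N then dn i else cst 0.
have mdn' i : measurable_fun setT (dn' i).
  by rewrite /dn'; case: ifPn => [/mdn|].
have mS : measurable_fun setT (fun w => sqnorm mu (T0^~ w)).
  exact: (measurable_sqnorm_section mT0).
apply: (@le_trans _ _ (\int[P]_w ((2 * a)%:E * sqnorm mu (T0^~ w) +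
    \sum_(i <- KL_index n) (2 * A i.1)%:E * (dn' i w ^+ 2)%:E))%E).
  apply: ge0_le_integral => //.
  - by move=> w _; exact: sqnorm_ge0.
  - by apply: measurable_sqnorm_section; exact: measurable_KL_increment.
  - apply: emeasurable_funD; first exact: measurable_funeM.
    by apply: emeasurable_sum => i; apply: measurable_funeM; exact: measurable_sqr.
  move=> w _; rewrite /KL_increment /=.
  rewrite (sqnorm_orthonormal (KL_index_uniq n) ei oe).
  have mTw : measurable_fun setT (T0^~ w).
    exact: (measurableT_comp mT0 (pair1_measurable w)).
  apply: (@le_trans _ _ ((2 * a)%:E * (\sum_(i <- KL_index n) ip i w ^+ 2)%:E +
      (\sum_(i <- KL_index n) 2 * A i.1 * dn' i w ^+ 2)%:E)%E); last first.
    apply: leeD.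
      apply: lee_wpmul2l; first by rewrite lee_fin mulr_ge0 // sqr_ge0.
      exact: (bessel (KL_index_uniq n) ei oe mTw).
    by rewrite -sumEFin; apply: lee_sum => i _; rewrite EFinM.
  rewrite -EFinM -EFinD lee_fin mulr_sumr -big_split /= big_seq [leRHS]big_seq.
  apply: ler_sum => i /KL_index_le il; rewrite /dn' il /KL_coef -/(ip i w).
  set E1 := expR _; set E2 := expR _.
  have -> : E1 * ip i w + Num.sqrt (A i.1) * noise_coef I1 I2 i.1 i.2 (t + h) w -
     (E2 * ip i w + Num.sqrt (A i.1) * noise_coef I1 I2 i.1 i.2 t w) =
     (E1 - E2) * ip i w + Num.sqrt (A i.1) * dn i w by rewrite /dn; ring.
  have E12 : (E1 - E2) ^+ 2 <= a.
    rewrite -real_normK ?num_real // lerXn2r ?nnegrE ?powR_ge0 //.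
    by apply: le_trans hH; exact: initial_coef_increment.
  have sA : Num.sqrt (A i.1) ^+ 2 = A i.1 by rewrite sqr_sqrtr.
  move: (ip i w) (dn i w) (Num.sqrt (A i.1)) sA => u v s <-.
  have h1 : ((E1 - E2) * u) ^+ 2 <= a * u ^+ 2 by rewrite exprMn ler_wpM2r ?sqr_ge0.
  have h2 := sqr_ge0 ((E1 - E2) * u - s * v).
  by move: h1 h2; move: ((E1 - E2) * u) => y; lra.
rewrite ge0_integralD //; first last.
- by apply: emeasurable_sum => i; apply: measurable_funeM; exact: measurable_sqr.
- by move=> w _; apply: sume_ge0 => i _; rewrite mule_ge0 // lee_fin ?sqr_ge0 // mulr_ge0.
- exact: measurable_funeM.
- by move=> w _; rewrite mule_ge0 ?sqnorm_ge0 // lee_fin mulr_ge0 // sqr_ge0.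
rewrite ge0_integralZl_EFin //; first last.
- by rewrite mulr_ge0 // sqr_ge0.
- by move=> w _; exact: sqnorm_ge0.
rewrite (sqnorm_initial_field ET) ge0_integral_sum //; first last.
- by move=> i w _; rewrite mule_ge0 // lee_fin ?sqr_ge0 // mulr_ge0.
- by move=> i; apply: measurable_funeM; exact: measurable_sqr.
rewrite -EFinM.
pose b l := 4 * (Num.max 1 t) ^+ 2 * (1 + psil l) ^+ 2 * a.
apply: (@le_trans _ _ ((2 * a * c)%:E + (\sum_(i <- KL_index n) 2 * A i.1 * b i.1)%:E)%E).
  apply: leeD => //; rewrite -sumEFin big_seq [leRHS]big_seq; apply: lee_sum => i /KL_index_le il.
  rewrite ge0_integralZl_EFin //; first last.
  - by rewrite mulr_ge0.
  - exact: measurable_sqr.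
  - by move=> w _; rewrite lee_fin sqr_ge0.
  rewrite [leRHS]EFinM lee_wpmul2l ?lee_fin ?mulr_ge0 // /dn' il.
  exact: sqnorm_noise_coef_increment.
rewrite -EFinD lee_fin sum_KL_index /=.
under eq_bigr => l _ do rewrite sumr_const card_ord -[_ *+ (2 * l).+1]mulr_natl.
(* All orders of degree [l] share the bound [b l], hence the multiplicity [2 l + 1]; 8 is the 2 of
   the split square times the 4 in [b]. *)
have -> : \sum_(l < n) (2 * l).+1%:R * (2 * A l * b l) =
    (8 * (Num.max 1 t) ^+ 2 * a) * \sum_(l < n) (2 * l + 1)%N%:R * ((1 + psil l) ^+ 2 * A l).
  by rewrite mulr_sumr; apply: eq_bigr => l _; rewrite /b addn1; ring.
have k0 : 0 <= 8 * (Num.max 1 t) ^+ 2 * a by rewrite mulr_ge0 ?sqr_ge0 // mulr_ge0 ?sqr_ge0.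
have := ler_wpM2l k0 qle; rewrite -/a => hq.
by apply: (le_trans (lerD (lexx _) hq)); rewrite le_eqVlt; apply/orP; left; apply/eqP; ring.
Qed.

End increments.

(* Without [0 < t + t0] the claim fails: for [t = t0 = 0] the initial field
   contributes [sum_l (2l+1) C_l (1 - exp(-psi(lambda_l) h))^2] to the squared
   norm, and the summability hypothesis puts no weight on [C_l]. *)
Theorem theorem4p9 (R : realType) (alpha gamma t : R) (Cl Al : R^nat)
    (halpha : 0 <= alpha) (hgamma : 0 < gamma) (ht : 0 <= t)
    (hAl : forall l, 0 < Al l)
    (hAsum : cvgn [series (2 * l + 1)%N%:R * Al l]_l)
    (hsum : cvgn [series (2 * l + 1)%N%:R *
              (Cl l + (1 + psi alpha gamma (eigval R l)) ^+ 2 * Al l)]_l) :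
  exists C : R,
    forall (d : measure_display) (Omega : measurableType d)
      (P : probability Omega R) (H t0 : R)
      (T0 : S2 R -> Omega -> R)
      (beta1 beta2 I1 I2 : nat -> nat -> R -> Omega -> R)
      (X : R -> Omega -> S2 R -> R[i]),
    2^-1 <= H < 1 -> 0 <= t0 -> 0 < t + t0 ->
    initial_field P T0 Cl ->
    fBm_components P H beta1 beta2 ->
    OU_integrals P alpha gamma 0 beta1 I1 ->
    OU_integrals P alpha gamma 1 beta2 I2 ->
    KL_solution P alpha gamma t0 Al T0 I1 I2 X ->
    \forall h \near 0^'+,
      (L2norm P (fun w x => X (t + h) w x - X t w x)%R <= (C * h `^ H)%R%:E)%E.
Proof.
(* [c] will be the second moment of [T0] at any point. [q], the sum of the noise series, is obtained
   by subtraction because the hypothesis controls the two series together. *)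
pose c := limn [series Cl l * (2 * l + 1)%N%:R]_l.
pose q := limn [series (2 * l + 1)%N%:R *
  (Cl l + (1 + psi alpha gamma (eigval R l)) ^+ 2 * Al l)]_l - c.
(* The 3 comes from [sqL2_le3], the rest from [sqnorm_KL_increment]; neither [H] nor [t0] occurs. *)
exists (Num.sqrt (3 * (2 * (c + 4 * (Num.max 1 t) ^+ 2 * q)))).
move=> d Omega P H t0 T0 beta1 beta2 I1 I2 X H12 t00 tt0 hT0 hbeta hI1 hI2 hX.
have [mT0 _ _ _ aps] := hT0.
have serC x : [series Cl l * (2 * l + 1)%N%:R * (legendre R l).[dotS x x]]_l =
    [series Cl l * (2 * l + 1)%N%:R]_l.
  apply/funext => n; apply: eq_bigr => l _.
  by rewrite /= dotS_self legendre1 mulr1.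
have ET x : ('E_P[(fun w => T0 x w * T0 x w)%R] = c%:E)%E.
  have [c' -> cc'] := aps x x; congr EFin; rewrite serC in cc'.
  exact/esym/cvg_lim.
(* [Cl] is not assumed nonnegative: the convergence of its series is read off the
   covariance of [T0] at coinciding points. *)
have cvgC : [series Cl l * (2 * l + 1)%N%:R]_l @ \oo --> c.
  have [c' _] := aps point point; rewrite serC => cc'.
  exact: (cvgP _ cc').
have qle n : \sum_(l < n) (2 * l + 1)%N%:R * ((1 + psi alpha gamma (eigval R l)) ^+ 2 * Al l) <= q.
  pose s := [series (2 * l + 1)%N%:R * ((1 + psi alpha gamma (eigval R l)) ^+ 2 * Al l)]_l.
  have cs : s @ \oo --> q.
    have -> : s = [series (2 * l + 1)%N%:R *
        (Cl l + (1 + psi alpha gamma (eigval R l)) ^+ 2 * Al l)]_l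
        \- [series Cl l * (2 * l + 1)%N%:R]_l.
      by apply/funext => k; rewrite /s /series /= -sumrB; apply: eq_bigr => l _; ring.
    exact: cvgB hsum cvgC.
  have s_nd : {homo s : m n / (m <= n)%N >-> m <= n}.
    apply/nondecreasing_seqP => k; rewrite /s /series /= big_nat_recr //= lerDl.
    by rewrite mulr_ge0 // mulr_ge0 ?sqr_ge0 // ltW.
  have := nondecreasing_cvgn_le s_nd (cvgP _ cs) n.
  by rewrite (cvg_lim _ cs) // /s /series /= big_mkord.
have /andP[H1 H2] := H12.
near=> h.
have h0 : 0 < h by near: h; exact: nbhs_right_gt.
have h1 : h <= 1 by near: h; exact: nbhs_right_le.
have hh : h / (t + t0) <= h `^ H.
  (* This threshold is equivalent to [h^{1-H} <= t + t0]; the dependence on [H] and [t0] is confined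
     to it. *)
  have h2 : h <= (t + t0) `^ (1 - H)^-1.
    by near: h; apply: nbhs_right_le; rewrite powR_gt0.
  have H1H : 0 < 1 - H by rewrite subr_gt0.
  have h3 : h `^ (1 - H) <= t + t0.
    have tE : ((t + t0) `^ (1 - H)^-1) `^ (1 - H) = t + t0.
      by rewrite -powRrM mulVf ?lt0r_neq0 // powRr1 // ltW.
    rewrite -[leRHS]tE.
    by apply: ge0_ler_powR; rewrite ?nnegrE ?powR_ge0 // ltW.
  rewrite ler_pdivrMr //; apply: le_trans (ler_wpM2l (powR_ge0 h H) h3).
  rewrite -powRD; last by rewrite (lt0r_neq0 h0) implybT.
  by rewrite (addrC H) subrK powRr1 // ltW.
have th0 : 0 <= t + h by rewrite addr_ge0 // ltW.
apply: L2norm_le_of_sqL2; first exact: powR_gt0.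
apply/lee_addgt0Pr => eps eps0.
(* Two truncation errors [e^2 = eps / 6], each multiplied by 3, add up to [eps]. *)
pose e := Num.sqrt (eps / 6).
have e0 : 0 < e by rewrite sqrtr_gt0 divr_gt0.
pose S n s w x := \sum_(l < n)
  (initial_term alpha gamma t0 T0 l s w x + noise_term Al I1 I2 l s w x).
pose KS n s (z : Omega * S2 R) := \sum_(i <- KL_index n)
  KL_coef alpha gamma t0 Al T0 I1 I2 i s z.1 * real_sph_harm i.1 i.2 z.2.
have SE n s w x : S n s w x = (KS n s (w, x))%:C.
  by apply: KL_partial_sumE; exact: (measurableT_comp mT0 (pair1_measurable w)).
have mKS n s : 0 <= s -> measurable_fun setT (KS n s).
  move=> s0.
  apply: (@measurable_KL_sum _ _ _ n (fun i => KL_coef alpha gamma t0 Al T0 I1 I2 i s)) => i il.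
  exact: (KL_coef_measurable t0 Al hI1 hI2 mT0 il s0).
have mRe n s : 0 <= s ->
    measurable_fun setT (fun z : Omega * S2 R => complex.Re (X s z.1 z.2 - S n s z.1 z.2)).
  move=> s0; have [mr _ _] := hX _ s0.
  have -> : (fun z : Omega * S2 R => complex.Re (X s z.1 z.2 - S n s z.1 z.2)) =
      (fun z => complex.Re (X s z.1 z.2) - KS n s z).
    by apply/funext => -[w x]; rewrite SE /=; case: (X s w x).
  by apply: measurable_funB => //; exact: mKS.
have mIm n s : 0 <= s ->
    measurable_fun setT (fun z : Omega * S2 R => complex.Im (X s z.1 z.2 - S n s z.1 z.2)).
  move=> s0; have [_ mi _] := hX _ s0.
  have -> // : (fun z : Omega * S2 R => complex.Im (X s z.1 z.2 - S n s z.1 z.2)) =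
      (fun z => complex.Im (X s z.1 z.2)).
  by apply/funext => -[w x]; rewrite SE /=; case: (X s w x) => a b /=; rewrite subr0.
have small s : 0 <= s ->
    \forall n \near \oo, (L2norm P (fun w x => X s w x - S n s w x)%R < e%:E)%E.
  move=> s0; have [_ _ cv] := hX _ s0.
  by apply: (cv [set y | (y < e%:E)%E]); apply: open_ereal_lt'; rewrite lte_fin.
(* One truncation level must serve both times, so that the two partial sums differ by
   [KL_increment n]. *)
have [n [n1 n2]] : exists n, (L2norm P (fun w x => X (t + h) w x - S n (t + h) w x)%R < e%:E)%E /\
    (L2norm P (fun w x => X t w x - S n t w x)%R < e%:E)%E.
  have [N _ hN] := filterI (small _ th0) (small _ ht).
  by exists N; exact: (hN N (leqnn N)).
have n1' := sqL2_le_of_L2norm_lt e0 n1; have n2' := sqL2_le_of_L2norm_lt e0 n2.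
have mD := measurable_KL_increment t0 Al hI1 hI2 mT0 n ht (ltW h0).
have Dle := sqnorm_KL_increment H12 hbeta hI1 hI2 mT0 ht (introT andP (conj h0 h1)) tt0 hh
  (fun l => ltW (hAl l)) ET (qle n).
have ZE w x : X (t + h) w x - X t w x =
    (X (t + h) w x - S n (t + h) w x) - (X t w x - S n t w x)
    + (KL_increment alpha gamma t0 Al T0 I1 I2 n t h (w, x))%:C.
  have -> : (KL_increment alpha gamma t0 Al T0 I1 I2 n t h (w, x))%:C = S n (t + h) w x - S n t w x.
    rewrite !SE -rmorphB; congr (_ +i* _); rewrite /KS -sumrB; apply: eq_bigr => i _.
    by rewrite mulrBl.
  by ring.
pose Z w x := X (t + h) w x - X t w x.
pose U s w x := X s w x - S n s w x.
have := @sqL2_le3 _ _ _ P Z (U (t + h)) (U t) _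
  (mRe _ _ th0) (mIm _ _ th0) (mRe _ _ ht) (mIm _ _ ht) mD ZE.
move=> /le_trans; apply.
have e2 : e ^+ 2 = eps / 6 by rewrite sqr_sqrtr // divr_ge0 // ltW.
apply: (@le_trans _ _ (3%:E * ((e ^+ 2)%:E + ((e ^+ 2)%:E +
   (2 * (c + 4 * (Num.max 1 t) ^+ 2 * q) * (h `^ H) ^+ 2)%:E)))%E).
  apply: lee_wpmul2l; first by rewrite lee_fin.
  by apply: leeD; [exact: n1'|apply: leeD; [exact: n2'|exact: Dle]].
rewrite -!EFinD -EFinM lee_fin e2 le_eqVlt; apply/orP; left; apply/eqP.
by field.
Unshelve. all: by end_near.
Qed.
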